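(* Let $\mathcal{H}=\bigcap_{H\in\mathcal{F}(\mathcal{H})}\mathrm{Forb}(H)$ be a hereditary property of graphs, and let $\mathcal{K}(\mathcal{H})$ denote the set of all colored regularity graphs (CRGs) $K$ such that $H\not\mapsto_c K$ for each $H\in\mathcal{F}(\mathcal{H})$. Then the limit $$d^*(\mathcal{H}):=\lim_{n\to\infty}\mathrm{Dist}(n,\mathcal{H})\Big/\binom{n}{2}$$ exists. Define, for $p\in[0,1]$, $$f(p):=\inf_{K\in\mathcal{K}(\mathcal{H})}f_K(p)\qquad\text{and}\qquad g(p):=\inf_{K\in\mathcal{K}(\mathcal{H})}g_K(p).$$ Then $f(p)=g(p)$ for all $p\in[0,1]$, $$d^*(\mathcal{H})=\max_{p\in[0,1]}f(p)=\max_{p\in[0,1]}g(p),$$ and $p^*(\mathcal{H})$ is the value of $p$ at which $f$ achieves its maximum. In addition, the function $f(p)=g(p)$ is concave on $[0,1]$. Furthermore, for all $p\in(0,1)$, $$\max\left\{\mathrm{Dist}(G,\mathcal{H}) : |V(G)|=n,\ e(G)=\left\lfloor p\tbinom{n}{2}\right\rfloor\right\}=f(p)\binom{n}{2}+o(n^2)\quad (n\to\infty),$$ and for all $\epsilon>0$, $$\mathrm{Dist}\left(G\left(n,p\tbinom{n}{2}\right),\mathcal{H}\right)\ge f(p)\binom{n}{2}-\epsilon n^2$$ with probability approaching $1$ as $n\to\infty$.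
   Context: All graphs are finite and simple; $e(G)$ is the number of edges of $G$. For a class of graphs $\mathcal{P}$ and a graph $G$, $\mathrm{Dist}(G,\mathcal{P})=\min\{|E(F)\triangle E(G)| : F\in\mathcal{P},\,V(F)=V(G)\}$ and $\mathrm{Dist}(n,\mathcal{P})=\max\{\mathrm{Dist}(G,\mathcal{P}):|V(G)|=n\}$. A hereditary property is a class of graphs (closed under isomorphism) closed under deletion of vertices; it is understood to contain graphs of every order, so that the minimum above is over a nonempty set. $\mathrm{Forb}(H)$ is the class of graphs with no induced copy of $H$. $\mathcal{F}(\mathcal{H})$ is the family of graphs that are minimal (under taking induced subgraphs) among graphs not in $\mathcal{H}$, so $\mathcal{H}=\bigcap_{H\in\mathcal{F}(\mathcal{H})}\mathrm{Forb}(H)$. A value $p^*(\mathcal{H})\in[0,1]$ is one such that, with high probability, $\mathrm{Dist}(n,\mathcal{H})=\mathrm{Dist}(G(n,p^*(\mathcal{H})),\mathcal{H})+o(n^2)$, where $G(n,p)$ with $p\in[0,1]$ is the Erdős–Rényi random graph on $n$ vertices in which each edge is present independently with probability $p$; $p^*$ is not necessarily unique (the assertion about $p^*(\mathcal{H})$ is that it is given by a maximizer of $f$). For $m\ge 1$, $G(n,m)$ is a uniformly random graph among all $n$-vertex graphs with $\lfloor m\rfloor$ edges. A colored regularity graph (CRG) $K$ is a (finite, nonempty) complete graph together with a partition of its vertices $V(K)=\mathrm{VW}(K)\,\dot\cup\,\mathrm{VB}(K)$ into white and black vertices and a partition of its edges $E(K)=\mathrm{EW}(K)\,\dot\cup\,\mathrm{EG}(K)\,\dot\cup\,\mathrm{EB}(K)$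 into white, gray and black edges. A colored-homomorphism from a graph $F$ to a CRG $K$ is a map $\varphi:V(F)\to V(K)$ such that: (1) if $\{u,v\}\in E(F)$, then either $\varphi(u)=\varphi(v)\in\mathrm{VB}(K)$, or $\varphi(u)\ne\varphi(v)$ and $\{\varphi(u),\varphi(v)\}\in\mathrm{EB}(K)\cup\mathrm{EG}(K)$; (2) if $u\neq v$ and $\{u,v\}\notin E(F)$, then either $\varphi(u)=\varphi(v)\in\mathrm{VW}(K)$, or $\varphi(u)\ne\varphi(v)$ and $\{\varphi(u),\varphi(v)\}\in\mathrm{EW}(K)\cup\mathrm{EG}(K)$. Write $F\mapsto_c K$ if such a map exists, and $F\not\mapsto_c K$ otherwise. For a CRG $K$ on $k$ vertices and $p\in[0,1]$, $$f_K(p)=\frac{1}{k^2}\left[p\left(|\mathrm{VW}(K)|+2|\mathrm{EW}(K)|\right)+(1-p)\left(|\mathrm{VB}(K)|+2|\mathrm{EB}(K)|\right)\right].$$ Let $\mathbf{M}_K(p)$ be the symmetric $k\times k$ matrix indexed by $V(K)$ whose diagonal entry at $v$ is $p$ if $v$ is white and $1-p$ if $v$ is black, and whose off-diagonal entry at $(u,v)$ is $p$, $1-p$ or $0$ according to whether the edge $\{u,v\}$ is white, black or gray. Then $$g_K(p)=\min\{\mathbf{u}^T\mathbf{M}_K(p)\mathbf{u} : \mathbf{u}\in\mathbb{R}^k,\ \mathbf{u}^T\mathbf{1}=1,\ \mathbf{u}\ge\mathbf{0}\}.$$ *)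

(* Defs.v *)
(* MathComp-Analysis; the reals are an arbitrary R : realType. *)
From HB Require Import structures.
From mathcomp Require Import all_boot all_order perm all_algebra.
From mathcomp Require Import all_classical all_reals all_analysis.

Set Implicit Arguments.
Unset Strict Implicit.
Unset Printing Implicit Defensive.

Import Order.TTheory GRing.Theory Num.Theory.
Import numFieldNormedType.Exports.

Local Open Scope classical_set_scope.
Local Open Scope set_scope.
Local Open Scope ring_scope.

(* Edges are two-element vertex sets, so graphs are loopless and undirected by
   construction and sgraph n is a finite type. *)
Record sgraph (n : nat) := SGraph {
  edges : {set {set 'I_n}};
  edges_card2 : edges \subset [set e : {set 'I_n} | #|e| == 2%N] }.

HB.instance Definition _ n := [isSub for @edges n].
HB.instance Definition _ n := [Finite of sgraph n by <:].

Definition adj n (G : sgraph n) (u v : 'I_n) : bool := [set u; v] \in edges G.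

Definition nb_edges n (G : sgraph n) : nat := #|edges G|.

Lemma induced_subproof m n (phi : 'I_m -> 'I_n) (G : sgraph n) :
  [set e : {set 'I_m} | (#|e| == 2%N) && (phi @: e \in edges G)]
    \subset [set e : {set 'I_m} | #|e| == 2%N].
Proof. by apply/fintype.subsetP => e; rewrite !inE => /andP[]. Qed.

(* For injective phi, the subgraph of G induced on the image of phi, relabelled
   along phi (an isomorphic copy of G when phi is bijective). *)
Definition induced m n (phi : 'I_m -> 'I_n) (G : sgraph n) : sgraph m :=
  SGraph (induced_subproof phi G).

Definition graph_class := forall n : nat, set (sgraph n).

Definition iso_closed (P : graph_class) : Prop :=
  forall n (s : {perm 'I_n}) (G : sgraph n), P n G -> P n (induced s G).

Definition vertex_deletion_closed (P : graph_class) : Prop :=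
  forall n (v : 'I_n.+1) (G : sgraph n.+1), P n.+1 G -> P n (induced (lift v) G).

Definition hereditary (P : graph_class) : Prop :=
  [/\ iso_closed P, vertex_deletion_closed P & forall n, exists G, P n G].

Definition contains_induced n (G : sgraph n) m (F : sgraph m) : Prop :=
  exists2 phi : 'I_m -> 'I_n, injective phi & induced phi G = F.

Definition Forb m (F : sgraph m) : graph_class :=
  fun n => [set G : sgraph n | ~ contains_induced G F]%classic.

(* Minimality is with respect to induced subgraphs; a proper one has strictly
   fewer vertices. *)
Definition minimal_forbidden (P : graph_class) : graph_class :=
  fun n => [set G : sgraph n | ~ P n G /\
    forall m (F : sgraph m), (m < n)%N -> contains_induced G F -> P m F]%classic.

Definition edit_dist n (F G : sgraph n) : nat :=
  #|(edges F :\: edges G) :|: (edges G :\: edges F)|.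

(* The neutral value 'C(n, 2) bounds every edit_dist, so this is the minimum as
   soon as P contains a graph on n vertices. *)
Definition Dist (P : graph_class) n (G : sgraph n) : nat :=
  \big[minn/'C(n, 2)]_(F in P n) edit_dist F G.

Definition maxDist (P : graph_class) (n : nat) : nat :=
  \max_(G : sgraph n) Dist P G.

Definition maxDist_size (P : graph_class) (n : nat) (m : int) : nat :=
  \max_(G : sgraph n | (nb_edges G)%:Z == m) Dist P G.

Definition edit_ratio (R : realType) (P : graph_class) (n : nat) : R :=
  (maxDist P n)%:R / 'C(n, 2)%:R.

Definition dstar (R : realType) (P : graph_class) : R :=
  limn (edit_ratio R P).

Definition gnp_pmf (R : realType) n (p : R) (G : sgraph n) : R :=
  \prod_(e : {set 'I_n} | #|e| == 2%N) (if e \in edges G then p else 1 - p).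

Definition Pr_gnp (R : realType) n (p : R) (A : set (sgraph n)) : R :=
  \sum_(G in A) gnp_pmf p G.

Definition Pr_gnm (R : realType) n (m : R) (A : set (sgraph n)) : R :=
  #|[set G : sgraph n | ((nb_edges G)%:Z == Num.floor m) && (G \in A)]|%:R /
  #|[set G : sgraph n | (nb_edges G)%:Z == Num.floor m]|%:R.

Definition is_pstar (R : realType) (P : graph_class) (p : R) : Prop :=
  forall eps : R, 0 < eps ->
    Pr_gnp p [set G : sgraph n |
      `|(maxDist P n)%:R - (Dist P G)%:R| <= eps * n%:R ^+ 2]%classic
    @[n --> \oo] --> (1 : R).

Variant vertex_color := VWhite | VBlack.
Variant edge_color := EWhite | EGray | EBlack.

(* Only the values of ecolor on two-element sets are meaningful. *)
Record crg := CRG {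
  crg_order : nat;
  crg_order_gt0 : (0 < crg_order)%N;
  vcolor : 'I_crg_order -> vertex_color;
  ecolor : {set 'I_crg_order} -> edge_color }.

Definition VW (K : crg) : {set 'I_(crg_order K)} :=
  [set v | if vcolor v is VWhite then true else false].
Definition VB (K : crg) : {set 'I_(crg_order K)} :=
  [set v | if vcolor v is VBlack then true else false].
Definition EW (K : crg) : {set {set 'I_(crg_order K)}} :=
  [set e : {set _} | (#|e| == 2%N) && if ecolor e is EWhite then true else false].
Definition EG (K : crg) : {set {set 'I_(crg_order K)}} :=
  [set e : {set _} | (#|e| == 2%N) && if ecolor e is EGray then true else false].
Definition EB (K : crg) : {set {set 'I_(crg_order K)}} :=
  [set e : {set _} | (#|e| == 2%N) && if ecolor e is EBlack then true else false].

Definition colored_hom n (F : sgraph n) (K : crg)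
    (phi : 'I_n -> 'I_(crg_order K)) : Prop :=
  (forall u v, adj F u v ->
     (phi u = phi v /\ phi u \in VB K) \/
     (phi u <> phi v /\ [set phi u; phi v] \in EB K :|: EG K)) /\
  (forall u v, u <> v -> ~~ adj F u v ->
     (phi u = phi v /\ phi u \in VW K) \/
     (phi u <> phi v /\ [set phi u; phi v] \in EW K :|: EG K)).

Definition maps_to n (F : sgraph n) (K : crg) : Prop :=
  exists phi, @colored_hom n F K phi.

Definition crgs_of (P : graph_class) : set crg :=
  [set K | forall n (F : sgraph n), minimal_forbidden P F -> ~ maps_to F K]%classic.

Definition fK (R : realType) (K : crg) (p : R) : R :=
  ((crg_order K)%:R ^+ 2)^-1 *
  (p * (#|VW K|%:R + 2 * #|EW K|%:R) + (1 - p) * (#|VB K|%:R + 2 * #|EB K|%:R)).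

Definition MK (R : realType) (K : crg) (p : R) : 'M[R]_(crg_order K) :=
  \matrix_(u, v)
    if u == v then (if vcolor u is VWhite then p else 1 - p)
    else match ecolor [set u; v] with
         | EWhite => p
         | EBlack => 1 - p
         | EGray => 0
         end.

Definition simplex (R : realType) (k : nat) : set 'cV[R]_k :=
  [set u | (\sum_i u i 0 = 1) /\ forall i, 0 <= u i 0]%classic.

Definition qform (R : realType) (K : crg) (p : R) (u : 'cV[R]_(crg_order K)) : R :=
  (u^T *m MK K p *m u) 0 0.
Arguments qform {R} K p u.

(* An attained minimum, by gK_min below. *)
Definition gK (R : realType) (K : crg) (p : R) : R :=
  inf [set qform K p u | u in @simplex R (crg_order K)]%classic.

Definition f_of (R : realType) (P : graph_class) (p : R) : R :=
  inf [set fK K p | K in crgs_of P]%classic.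

Definition g_of (R : realType) (P : graph_class) (p : R) : R :=
  inf [set gK K p | K in crgs_of P]%classic.

Definition is_max_on (R : realType) (D : set R) (h : R -> R) (m : R) : Prop :=
  (exists2 p, D p & h p = m) /\ (forall p, D p -> h p <= m).

Lemma induced_comp l m n (psi : 'I_l -> 'I_m) (phi : 'I_m -> 'I_n)
    (G : sgraph n) : injective psi ->
  induced psi (induced phi G) = induced (phi \o psi) G.
Proof.
move=> psiI; apply: val_inj; apply/finset.setP => e /=; rewrite !inE (imset_comp phi psi).
by rewrite (card_imset _ psiI) andbA andbb.
Qed.

Lemma eq_induced m n (phi psi : 'I_m -> 'I_n) (G : sgraph n) :
  phi =1 psi -> induced phi G = induced psi G.
Proof. by move=> E; congr induced; apply/funext. Qed.

Lemma induced_id n (G : sgraph n) : induced id G = G.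
Proof.
apply: val_inj; apply/finset.setP => e; rewrite !inE imset_id.
by case eG: (e \in edges G); rewrite ?andbF ?andbT //;
   have /fintype.subsetP/(_ e eG) := edges_card2 G; rewrite inE.
Qed.

Lemma hereditary_induced (P : graph_class) m n (phi : 'I_m -> 'I_n)
    (G : sgraph n) :
  hereditary P -> injective phi -> P n G -> P m (induced phi G).
Proof.
move=> [isoP delP _]; elim: n phi G => [|n IHn] phi G phiI PG.
  case: m phi phiI => [|m] phi phiI; last by case: (phi ord0).
  rewrite (@eq_induced _ _ phi id) ?induced_id //; by case.
have [/fintype.forallP surj|] := boolP [forall v, v \in codom phi].
  have mn : m = n.+1.
    apply/eqP; rewrite eqn_leq; apply/andP; split.
      by have := leq_card phi phiI; rewrite !card_ord.
    have := leq_image_card phi predT; rewrite card_ord.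
    by rewrite (eq_card (B := predT)) ?card_ord // => v; exact: surj.
  case: _ / (esym mn) phi phiI surj => phi phiI _.
  rewrite (@eq_induced _ _ phi (perm phiI)); first exact: isoP.
  by move=> i; rewrite permE.
rewrite negb_forall => /existsP[v vphi].
have hv i : v != phi i by apply: contraNneq vphi => ->; exact: codom_f.
pose psi i := s2val (unlift_some (hv i)).
have psiE i : phi i = lift v (psi i) by rewrite /psi; case: unlift_some.
rewrite (@eq_induced _ _ phi (lift v \o psi)) // -induced_comp.
  by apply: IHn (delP _ _ _ PG) => i j ij; apply: phiI; rewrite !psiE ij.
by move=> i j ij; apply: phiI; rewrite !psiE ij.
Qed.

Lemma hereditary_Forb (P : graph_class) n (G : sgraph n) : hereditary P ->
  P n G <-> forall m (F : sgraph m), minimal_forbidden P F -> Forb F G.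
Proof.
move=> hP; split=> [PG m F [nPF _] [phi phiI GF]|].
  by apply: nPF; rewrite -GF; exact: hereditary_induced.
move=> GForb; apply: contrapT => nPG.
have: exists m, `[< exists F : sgraph m, contains_induced G F /\ ~ P m F >].
  exists n; apply/asboolP; exists G; split=> //.
  by exists id => //; exact: induced_id.
case/ex_minnP => m /asboolP[F [[phi phiI GF] nPF]] minm.
apply: (GForb m F); last by exists phi.
split=> // l F' lm [psi psiI FF']; apply: contrapT => nPF'.
suff: (m <= l)%N by rewrite leqNgt lm.
apply: minm; apply/asboolP; exists F'; split=> //; exists (phi \o psi).
  exact: inj_comp.
by rewrite -induced_comp // GF.
Qed.

Lemma gK_min (R : realType) (K : crg) (p : R) :
  exists2 u, simplex u & qform K p u = gK K p /\
    forall v : 'cV_(crg_order K), simplex v -> qform K p u <= qform K p v.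
Proof.
pose k := crg_order K; pose S := [set v : 'rV[R]_k | simplex v^T]%classic.
have qE (v : 'rV[R]_k) : qform K p v^T =
    \sum_j (\sum_i v 0 i * MK K p i j) * v 0 j.
  rewrite /qform trmxK mxE; apply: eq_bigr => j _; rewrite !mxE.
  by congr (_ * _); apply: eq_bigr.
have S0 : (S !=set0)%classic.
  pose i0 := Ordinal (crg_order_gt0 K); exists (delta_mx 0 i0); split.
    rewrite (bigD1 i0) //= !mxE !eqxx big1 ?addr0 // => i /negPf ii0.
    by rewrite !mxE ii0 andbF.
  by move=> i; rewrite !mxE ler0n.
have cvgS (F : 'I_k -> 'rV[R]_k -> R) :
    (forall i, continuous (F i)) -> continuous (fun v => \sum_i F i v).
  by move=> cF v; apply: (cvg_big _ (nbhs_filter v)) => [|i _];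
    [exact: add_continuous|exact: cF].
have cS : compact S.
  have -> : S = ([set v : 'rV[R]_k | forall i, `[0, 1]%classic (v ord0 i)] `&`
     ((fun v : 'rV[R]_k => \sum_i v 0 i) @^-1` [set x | x = 1]))%classic.
    apply/seteqP; split => [v [v1 v0]|v [v01 /= v1]]; last first.
      split=> [|i]; first by rewrite -v1; apply: eq_bigr => i _; rewrite mxE.
      by have := v01 i; rewrite /= in_itv /= mxE => /andP[].
    have v1' : \sum_i v 0 i = 1 by rewrite -v1; apply: eq_bigr => i _; rewrite mxE.
    have v0' i : 0 <= v 0 i by have := v0 i; rewrite mxE.
    split=> //= i; rewrite in_itv /= v0' /= -v1' (bigD1 i) //= lerDl.
    exact: sumr_ge0.
  apply: compact_closedI.
    by apply: (@rV_compact R k (fun=> `[0, 1]%classic)) => i; exact: segment_compact.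
  apply: preimage_closed; last exact: closed_eq.
  by move=> v _; apply: cvgS => i; exact: coord_continuous.
have cM j : continuous (fun v : 'rV[R]_k => \sum_i v 0 i * MK K p i j).
  apply: (cvgS) => i v; apply: cvgM;
    [exact: nbhs_filter|exact: coord_continuous|].
  by apply: cvg_cst; exact: nbhs_filter.
have cq : continuous (fun v : 'rV[R]_k => qform K p v^T).
  rewrite (_ : (fun v => _) = fun v : 'rV[R]_k =>
     \sum_j (\sum_i v 0 i * MK K p i j) * v 0 j); last exact/funext.
  apply: cvgS => j v; apply: cvgM;
    [exact: nbhs_filter|exact: cM|exact: coord_continuous].
have [v vS vmin] := EVT_min_rV S0 cS (continuous_subspaceT cq).
rewrite inE in vS; exists v^T => //.
have vle (w : 'cV_k) : simplex w -> qform K p v^T <= qform K p w.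
  by move=> ws; have := vmin w^T; rewrite trmxK; apply; rewrite inE /S /= trmxK.
split=> //; apply/eqP; rewrite eq_le; apply/andP; split.
  apply: lb_le_inf; first by exists (qform K p v^T), v^T.
  by move=> _ [w ws <-]; exact: vle.
apply: ge_inf; last by exists v^T.
by exists (qform K p v^T) => _ [w ws <-]; exact: vle.
Qed.

(* Main.v *)
Require Import Defs.
From HB Require Import structures.
From mathcomp Require Import all_boot all_order perm all_algebra.
From mathcomp Require Import all_classical all_reals all_analysis.
From mathcomp Require Import ring lra zify.

(** Why the theorem holds.  Write [N] for ['C(n, 2)].

    Upper bound.  Let [K] be a CRG to which no minimal forbidden graph maps.  Send
    the vertices of a graph [G] to vertices of [K] independently and uniformly,
    and change the pairs of [G] that contradict the colors of [K].  The outcome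
    maps to [K], hence lies in [H], and the expected number of changes is exactly
    [N * fK K (e(G) / N)] ([Dist_upper]).  So [Dist H G <= N * f (e(G) / N)]
    ([Dist_le_f]).  The function [f] is an infimum of affine functions of slope at
    most one in absolute value; it is therefore concave and continuous and has a
    maximum on the unit interval.  It coincides with [g] because a vertex of
    weight [u] in the quadratic program is imitated by blowing it up
    proportionally to [u] ([f_of_le_qform]).

    Lower bound.  Let [G] be a graph whose density is close to [p] between any two
    vertex sets, and let [F] be a graph of [H] on the same vertices.  A CRG [K] of
    bounded order is extracted from [F] with [fK K p] at most about the fraction
    of pairs on which [F] and [G] differ ([edit_dist_lower]).  This is usually
    done with the strong regularity lemma; sampling is enough.  Classify vertices
    by their adjacency to a small set [T].  The mean square density of [F] between
    classes (the energy of [T]) is bounded, so some [T] of bounded size gains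
    almost nothing from any few extra vertices ([stable_set_exists]).  For such
    [T] the adjacencies within a random sample are nearly independent given the
    classes: when one pair is examined, the rest of the sample acts as extra
    vertices of [T] ([counting]).  Color a pair of vertices white, gray or black
    according to the density between their classes.  White and black pairs cost
    about [p] and [1 - p], because [G] has density [p] between unions of classes
    ([avg_weight_le]).  Some pattern of colors on [k] vertices is both cheap and
    frequent, hence so is its blow-up ([blowup]), and every graph compatible with
    a frequent pattern is induced in [F], so lies in [H] ([template]).  Ramsey's
    theorem makes the color inside each blown-up vertex constant, which yields the
    vertex colors of [K].

    Random graphs.  The discrepancy of a graph is bounded by the density of
    four-cycles in its centered adjacency matrix ([discrepancy_fourcycles]), whose
    mean tends to zero both for independent edges ([gnp_fourcycles]) and for a
    fixed number of edges ([gnm_fourcycles]); Markov's inequality finishes. *)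

Set Implicit Arguments.
Unset Strict Implicit.
Unset Printing Implicit Defensive.

Import Order.TTheory GRing.Theory Num.Theory.
Import numFieldNormedType.Exports.

Local Open Scope classical_set_scope.
Local Open Scope ring_scope.

(** * Averages over finite types *)

Section Averages.
Variable R : realFieldType.

Definition avg (T : finType) (f : T -> R) : R := (\sum_x f x) / #|T|%:R.

Lemma eq_avg (T : finType) (f g : T -> R) : f =1 g -> avg f = avg g.
Proof. by move=> fg; congr (_ / _); apply: eq_bigr. Qed.

Lemma avg_le (T : finType) (f g : T -> R) :
  (forall x, f x <= g x) -> avg f <= avg g.
Proof. by move=> fg; rewrite ler_wpM2r ?invr_ge0 ?ler0n// ler_sum. Qed.

Lemma avg_ge0 (T : finType) (f : T -> R) : (forall x, 0 <= f x) -> 0 <= avg f.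
Proof. by move=> f0; rewrite mulr_ge0 ?invr_ge0 ?ler0n// sumr_ge0. Qed.

Lemma avgD (T : finType) (f g : T -> R) :
  avg (fun x => f x + g x) = avg f + avg g.
Proof. by rewrite /avg big_split mulrDl. Qed.

Lemma avgB (T : finType) (f g : T -> R) :
  avg (fun x => f x - g x) = avg f - avg g.
Proof. by rewrite /avg sumrB mulrBl. Qed.

Lemma avgZ (T : finType) (c : R) (f : T -> R) :
  avg (fun x => c * f x) = c * avg f.
Proof. by rewrite /avg mulrA -mulr_sumr. Qed.

Lemma avg_sum (T I : finType) (P : pred I) (F : I -> T -> R) :
  avg (fun x => \sum_(i | P i) F i x) = \sum_(i | P i) avg (F i).
Proof. by rewrite /avg exchange_big mulr_suml. Qed.

Lemma avg_cst (T : finType) (c : R) : (0 < #|T|)%N -> avg (fun _ : T => c) = c.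
Proof.
move=> T0; rewrite /avg sumr_const -(mulr_natr c) mulfK //.
by rewrite pnatr_eq0 -lt0n.
Qed.

Lemma avg_cst_le (T : finType) (c : R) : 0 <= c -> avg (fun _ : T => c) <= c.
Proof.
have [T0|T0] := posnP #|T|; last by rewrite avg_cst.
by rewrite /avg T0 invr0 mulr0.
Qed.

Lemma avg_norm (T : finType) (f : T -> R) : `|avg f| <= avg (fun x => `|f x|).
Proof.
by rewrite /avg normrM normfV normr_nat ler_wpM2r ?invr_ge0 ?ler0n// ler_norm_sum.
Qed.

Lemma avg_exists (T : finType) (f : T -> R) : (0 < #|T|)%N ->
  exists x, f x <= avg f.
Proof.
move=> T0; apply: contrapT => /forallNP nf.
have {}nf x : avg f < f x by rewrite ltNge; apply/negP.
have : \sum_(x : T) avg f < \sum_x f x.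
  have /card_gt0P[x0 _] := T0.
  rewrite (bigD1 x0) //= [ltRHS](bigD1 x0) //=.
  by apply: ltr_leD => //; apply: ler_sum => x _; exact: ltW.
rewrite sumr_const -(mulr_natr (avg f)) divfK ?ltxx//.
by rewrite pnatr_eq0 -lt0n.
Qed.

Lemma avg_gt0_exists (T : finType) (f : T -> R) : 0 < avg f -> exists x, 0 < f x.
Proof.
move=> f0; apply: contrapT => /forallNP nf; move: f0; rewrite ltNge => /negP; apply.
rewrite -oppr_ge0 -mulN1r -avgZ; apply: avg_ge0 => x.
by rewrite mulN1r oppr_ge0 leNgt; apply/negP.
Qed.

(** Convexity of the power function, as the inequality between [x ^+ s] and its
    tangent line at [a]. *)
Lemma power_tangent (a x : R) n : 0 <= a -> 0 <= x ->
  x * a ^+ n *+ n.+1 <= x ^+ n.+1 + a ^+ n.+1 *+ n.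
Proof.
move=> a0 x0; elim: n => [|n IH].
  by rewrite expr0 mulr1 mulr0n addr0 expr1 lexx.
have sq : 0 <= a ^+ n * (x - a) ^+ 2 *+ n.+1.
  by apply: mulrn_wge0; apply: mulr_ge0; [exact: exprn_ge0|exact: sqr_ge0].
rewrite -subr_ge0 in IH; rewrite -subr_ge0.
rewrite (_ : _ - _ = x * (x ^+ n.+1 + a ^+ n.+1 *+ n - x * a ^+ n *+ n.+1) +
  a ^+ n * (x - a) ^+ 2 *+ n.+1); last by rewrite !exprS; ring.
by apply: addr_ge0 => //; exact: mulr_ge0.
Qed.

Lemma avg_power (T : finType) (f : T -> R) s : (forall x, 0 <= f x) ->
  (avg f) ^+ s.+1 <= avg (fun x => f x ^+ s.+1).
Proof.
move=> f0; have [T0|T0] := posnP #|T|.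
  by rewrite /avg T0 invr0 !mulr0 expr0n.
have a0 := avg_ge0 f0; set a := avg f in a0 *.
have : avg (fun x => f x * a ^+ s *+ s.+1 - a ^+ s.+1 *+ s)
   <= avg (fun x => f x ^+ s.+1).
  by apply: avg_le => x; rewrite lerBlDr power_tangent.
rewrite avgB avg_cst //; apply: le_trans.
rewrite (eq_avg (g := fun x => (a ^+ s *+ s.+1) * f x)); last first.
  by move=> x; rewrite mulrC mulrnAl.
rewrite avgZ -/a mulrnAl -exprSr.
by rewrite (mulrS (a ^+ s.+1) s) addrK.
Qed.

(** Resampling: if [put z w] overwrites part of [z] by [w] and [get] reads that
    part off, then [(z, w) |-> (put z w, get z)] is an involution, so that
    overwriting by an independent uniform [w] preserves the uniform
    distribution. *)
Lemma avg_resample (Z W : finType) (put : Z -> W -> Z) (get : Z -> W)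
    (f : Z -> R) :
  (0 < #|W|)%N ->
  (forall z w, get (put z w) = w) -> (forall z w w', put (put z w) w' = put z w') ->
  (forall z, put z (get z) = z) ->
  avg f = avg (fun z => avg (fun w => f (put z w))).
Proof.
move=> W0 gp pp pg; rewrite /avg -mulr_suml.
rewrite pair_big /= (reindex_inj (h := fun p => (put p.1 p.2, get p.1))) /=.
  rewrite (eq_bigr (fun p => f p.1)) => [|[z w] _ /=]; last by rewrite pp pg.
  rewrite -(pair_big predT predT (fun z _ => f z)) /=.
  congr (_ / _); under [in RHS]eq_bigr do rewrite sumr_const -mulr_natr.
  by rewrite -mulr_suml mulfK // pnatr_eq0 -lt0n.
apply: can_inj (fun p => (put p.1 p.2, get p.1)) _ => -[z w] /=.
by rewrite pp pg gp.
Qed.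

Lemma avg_pair (A B : finType) (f : A * B -> R) :
  avg f = avg (fun a => avg (fun b => f (a, b))).
Proof.
rewrite /avg -mulr_suml pair_big /= card_prod natrM invfM (mulrC #|A|%:R^-1) mulrA.
by congr (_ / _ / _); apply: eq_bigr => -[].
Qed.

End Averages.

(** * Conditional averages *)

Section ConditionalAverage.
Variables (R : realFieldType) (T : finType).
Implicit Types (f h : T -> R).

Definition condavg (W : eqType) (pi : T -> W) f (x : T) : R :=
  (\sum_(y | pi y == pi x) f y) / #|[pred y | pi y == pi x]|%:R.

Definition measurable_wrt (W : eqType) (pi : T -> W) h := forall x y, pi x = pi y -> h x = h y.

Lemma condavg_measurable (W : eqType) (pi : T -> W) f : measurable_wrt pi (condavg pi f).
Proof. by move=> x y; rewrite /condavg => ->. Qed.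

Lemma fiber_card_gt0 (W : eqType) (pi : T -> W) x : 0 < #|[pred y | pi y == pi x]|%:R :> R.
Proof. by rewrite ltr0n; apply/card_gt0P; exists x; rewrite inE. Qed.

(** [condavg pi f] is the orthogonal projection of [f] on the functions that are
    constant on the fibers of [pi]. *)
Lemma avg_condavg (W : eqType) (pi : T -> W) f h : measurable_wrt pi h ->
  avg (fun x => f x * h x) = avg (fun x => condavg pi f x * h x).
Proof.
move=> hm; congr (_ / _); rewrite /condavg.
under [RHS]eq_bigr do rewrite mulrAC mulr_suml mulr_suml.
rewrite (exchange_big_dep predT) //=; apply: eq_bigr => y _.
rewrite (eq_bigr (fun _ => f y * h y / #|[pred z | pi z == pi y]|%:R)); last first.
  by move=> x /eqP yx; rewrite (hm x y) // yx.
rewrite sumr_const -[RHS]mulr_natr (_ : #|_| = #|[pred z | pi z == pi y]|); last first.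
  by apply: eq_card => z; rewrite !inE eq_sym.
by rewrite divfK // gt_eqF // fiber_card_gt0.
Qed.

Lemma condavg_ge0 (W : eqType) (pi : T -> W) f x : (forall y, 0 <= f y) -> 0 <= condavg pi f x.
Proof. by move=> f0; rewrite divr_ge0 ?ler0n// sumr_ge0. Qed.

Lemma condavg_le1 (W : eqType) (pi : T -> W) f x : (forall y, f y <= 1) -> condavg pi f x <= 1.
Proof.
move=> f1; rewrite ler_pdivrMr ?fiber_card_gt0// mul1r -sum1_card natr_sum.
exact: ler_sum.
Qed.

(** Pythagoras for two successive conditional averages. *)
Lemma condavg_refine (W W' : eqType) (pi : T -> W) (pi' : T -> W') f :
  (forall x y, pi' x = pi' y -> pi x = pi y) ->
  avg (fun x => (condavg pi' f x - condavg pi f x) ^+ 2) =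
  avg (fun x => condavg pi' f x ^+ 2) - avg (fun x => condavg pi f x ^+ 2).
Proof.
move=> ref; set q' := condavg pi' f; set q := condavg pi f.
have qm : measurable_wrt pi q by exact: condavg_measurable.
have qm' : measurable_wrt pi' q by move=> x y /ref; exact: qm.
have q'q : avg (fun x => q' x * q x) = avg (fun x => q x ^+ 2).
  by rewrite -avg_condavg // (avg_condavg _ qm).
rewrite (eq_avg (g := fun x => q' x ^+ 2 + (q x ^+ 2 - 2 * (q' x * q x)))).
  by rewrite avgD avgB avgZ q'q; lra.
by move=> x; ring.
Qed.

End ConditionalAverage.

(** * Adjacency types and their energy *)

Section Types.
Local Open Scope set_scope.
Variables (R : realFieldType) (V : finType) (F : rel V).

Definition typ (T : {set V}) (x : V) : {set V} := [set z in T | F x z].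
Definition typ2 T (xy : V * V) := (typ T xy.1, typ T xy.2).
(** The density of [F] between the classes of [x] and of [y] in the partition of
    the vertices by adjacency to [T]. *)
Definition dens T : V * V -> R :=
  condavg (typ2 T) (fun xy => (F xy.1 xy.2)%:R).
Definition energy T : R := avg (fun xy => dens T xy ^+ 2).

Lemma typ_sub (T T' : {set V}) x y :
  T \subset T' -> typ T' x = typ T' y -> typ T x = typ T y.
Proof.
move=> /fintype.subsetP TT' /setP xy; apply/setP => z.
by have := xy z; rewrite !inE; case zT: (z \in T); rewrite ?(TT' _ zT).
Qed.

Lemma typ_adj (T : {set V}) x y z : z \in T -> typ T x = typ T y -> F x z = F y z.
Proof. by move=> zT /setP/(_ z); rewrite !inE zT. Qed.

Lemma dens_ge0 T xy : 0 <= dens T xy.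
Proof. by apply: condavg_ge0 => ?; rewrite ler0n. Qed.

Lemma dens_le1 T xy : dens T xy <= 1.
Proof. by apply: condavg_le1 => ?; rewrite lern1 leq_b1. Qed.

Lemma dens_typ T x y x' y' : typ T x = typ T x' -> typ T y = typ T y' ->
  dens T (x, y) = dens T (x', y').
Proof. by move=> xx' yy'; apply: condavg_measurable; rewrite /typ2 /= xx' yy'. Qed.

Lemma dens_sym T x y : symmetric F -> dens T (x, y) = dens T (y, x).
Proof.
move=> Fsym; pose sw (xy : V * V) := (xy.2, xy.1).
have swI : injective sw by apply: (can_inj (g := sw)) => -[].
have swE xy : (typ2 T (sw xy) == typ2 T (x, y)) = (typ2 T xy == typ2 T (y, x)).
  by rewrite /typ2 !xpair_eqE andbC.
rewrite /dens /condavg (reindex_inj swI) /=; congr (_ / _%:R).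
  by apply: eq_big => [xy|xy _]; [exact: swE|rewrite Fsym].
by rewrite -(card_imset _ swI); apply: eq_card => xy; rewrite !inE; apply/imsetP/idP
  => [[xy' + ->]|exy]; [rewrite inE -swE|exists (sw xy); rewrite ?inE ?swE //; case: (xy)].
Qed.

Lemma energy_le1 T : energy T <= 1.
Proof.
apply: le_trans (avg_cst_le (V * V)%type ler01); apply: avg_le => xy.
by rewrite expr_le1 ?dens_le1 ?dens_ge0.
Qed.

(** Enlarging [T] never decreases its energy, and the energy is at most [1], so
    only boundedly many enlargements can gain [eps]. *)
Lemma stable_set_exists (eps : R) (s M : nat) : 1 < M%:R * eps ->
  exists2 T : {set V}, (#|T| <= M * s)%N &
    forall S : {set V}, (#|S| <= s)%N -> energy (T :|: S) <= energy T + eps.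
Proof.
move=> Meps; apply: contrapT => nT.
have step (T : {set V}) : (#|T| <= M * s)%N ->
    exists2 S : {set V}, (#|S| <= s)%N & energy T + eps < energy (T :|: S).
  move=> Ts; apply: contrapT => nS; apply: nT; exists T => // S Ss.
  by rewrite leNgt; apply/negP => ?; apply: nS; exists S.
have grow j : (j <= M)%N ->
    exists2 T : {set V}, (#|T| <= j * s)%N & j%:R * eps <= energy T.
  elim: j => [_|j IH jM].
    exists finset.set0; first by rewrite cards0.
    by rewrite mul0r avg_ge0 // => ?; rewrite sqr_ge0.
  have [T Ts jT] := IH (ltnW jM).
  have [|S Ss TS] := step T.
    by apply: leq_trans Ts _; rewrite leq_mul2r (ltnW jM) orbT.
  exists (T :|: S).
    by rewrite (leq_trans (leq_card_setU _ _)) // mulSn addnC leq_add.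
  by rewrite -natr1; lra.
have [T _] := grow M (leqnn M); have := energy_le1 T; lra.
Qed.

(** By Pythagoras the squared distance of the two densities is the gain of energy,
    and [|d| <= (d ^ 2 / theta + theta) / 2] turns it into a bound in mean. *)
Lemma stable_close (T S : {set V}) (theta : R) : 0 < theta ->
  energy (T :|: S) <= energy T + theta ^+ 2 ->
  avg (fun xy => `|dens (T :|: S) xy - dens T xy|) <= theta.
Proof.
move=> th0 st.
have ref xy xy' : typ2 (T :|: S) xy = typ2 (T :|: S) xy' -> typ2 T xy = typ2 T xy'.
  by move=> [e1 e2]; rewrite /typ2; congr pair;
    apply: (@typ_sub T (T :|: S)); rewrite ?finset.subsetUl.
have py : avg (fun xy => (dens (T :|: S) xy - dens T xy) ^+ 2) =
    energy (T :|: S) - energy T by exact: condavg_refine.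
have -> : theta = theta^-1 * theta ^+ 2 / 2 + theta / 2 by field; rewrite gt_eqF.
apply: (@le_trans _ _ (avg (fun xy => theta^-1 / 2 *
    (dens (T :|: S) xy - dens T xy) ^+ 2 + theta / 2))).
  apply: avg_le => xy; set d := dens _ _ - _; rewrite -real_normK ?num_real //.
  rewrite -subr_ge0 (_ : _ - _ = theta^-1 / 2 * (`|d| - theta) ^+ 2).
    by rewrite mulr_ge0 ?sqr_ge0 // divr_ge0 // invr_ge0 ltW.
  by field; rewrite gt_eqF.
rewrite avgD (avgZ (theta^-1 / 2)).
rewrite py lerD //; last by apply: avg_cst_le; rewrite divr_ge0 ?ltW.
rewrite mulrAC ler_pM2r ?invr_gt0 // ler_pM2l ?invr_gt0 //.
by rewrite lerBlDl.
Qed.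

End Types.

(** * The counting lemma *)

Section Counting.
Local Open Scope set_scope.
Variables (R : realFieldType) (V : finType) (F : rel V) (I : finType).
Hypothesis Fsym : symmetric F.
Implicit Types (z : {ffun I -> V}) (T S : {set V}) (e : I * I).

Definition overwrite2 (i j : I) z (uv : V * V) : {ffun I -> V} :=
  [ffun l => if l == i then uv.1 else if l == j then uv.2 else z l].

Lemma avg_overwrite2 i j (f : {ffun I -> V} -> R) : i != j -> (0 < #|V|)%N ->
  avg f = avg (fun z => avg (fun uv => f (overwrite2 i j z uv))).
Proof.
move=> ij V0; apply: (avg_resample (get := fun z => (z i, z j))).
- by rewrite card_prod muln_gt0 V0.
- by move=> z [u v]; rewrite !ffunE eqxx eq_sym (negPf ij) eqxx.
- move=> z w w'; apply/ffunP => l; rewrite !ffunE.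
  by case: eqP => // _; case: eqP.
- move=> z; apply/ffunP => l; rewrite !ffunE /=.
  by case: eqP => [->|_] //; case: eqP => [->|].
Qed.

Section Telescope.
Variables (T : {set V}) (theta : R) (A : pred (I * I)).
Hypothesis V0 : (0 < #|V|)%N.
Hypothesis theta0 : 0 <= theta.
Hypothesis stableT : forall S : {set V}, (#|S| <= #|I|)%N ->
  avg (fun xy => `|dens R F (T :|: S) xy - dens R F T xy|) <= theta.

Definition agree e z : R := (F (z e.1) (z e.2) == A e)%:R.
Definition agree_dens e z : R :=
  if A e then dens R F T (z e.1, z e.2) else 1 - dens R F T (z e.1, z e.2).

Lemma agree_dens01 e z : 0 <= agree_dens e z <= 1.
Proof.
have := dens_ge0 R F T (z e.1, z e.2); have := dens_le1 R F T (z e.1, z e.2).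
by rewrite /agree_dens; case: ifP => _; lra.
Qed.

Lemma agree01 e z : 0 <= agree e z <= 1.
Proof. by rewrite ler0n lern1 leq_b1. Qed.

(** A weight [h] that sees the vertices [z i], [z j] only through their
    adjacencies to [T] and to the other sampled vertices does not distinguish
    the adjacency of [z i], [z j] from its conditional average on that
    information, which by stability is close to the one given [T] alone. *)
Lemma replace_one e (h : {ffun I -> V} -> R) : e.1 != e.2 ->
  (forall z, 0 <= h z <= 1) ->
  (forall z, measurable_wrt
     (typ2 F (T :|: [set z l | l in [set l | (l != e.1) && (l != e.2)]]))
     (fun uv => h (overwrite2 e.1 e.2 z uv))) ->
  `|avg (fun z => agree e z * h z) - avg (fun z => agree_dens e z * h z)| <= theta.
Proof.
case: e => i j /= ij h01 hm; rewrite -avgB (avg_overwrite2 _ ij V0).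
apply: le_trans (avg_norm _) _; apply: le_trans (avg_cst_le {ffun I -> V} theta0).
apply: avg_le => z; have {}hm := hm z; set S := imset _ _ in hm.
pose k uv := h (overwrite2 i j z uv).
have Fm : avg (fun xy => (F xy.1 xy.2)%:R * k xy) =
    avg (fun xy => dens R F (T :|: S) xy * k xy) by exact: avg_condavg.
have Sle : (#|S| <= #|I|)%N by rewrite (leq_trans (leq_imset_card _ _)) ?max_card.
apply: le_trans (stableT Sle).
rewrite (_ : avg _ = (-1) ^+ (~~ A (i, j)) *
  avg (fun uv => (dens R F (T :|: S) uv - dens R F T uv) * k uv)).
  rewrite normrM normr_sign mul1r; apply: le_trans (avg_norm _) _.
  apply: avg_le => uv; rewrite normrM ler_piMr //.
  by have := h01 (overwrite2 i j z uv); rewrite -/(k uv) => /andP[? ?]; rewrite ger0_norm.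
rewrite [in RHS](eq_avg (g := fun uv => dens R F (T :|: S) uv * k uv - dens R F T uv * k uv)).
  rewrite [X in _ = _ * X]avgB -Fm -avgB -avgZ; apply: eq_avg => -[u v].
  rewrite /agree /agree_dens /= !ffunE /= !eqxx (eq_sym j i) (negPf ij) /= -/(k (u, v)).
  by case: (A _); case: (F u v); rewrite /= ?expr0 ?expr1; ring.
by move=> uv; ring.
Qed.

(** The adjacencies are replaced by densities one pair at a time with
    [replace_one]; [mixed L1 L2] is the hybrid in which the pairs of [L1] are
    already replaced. The weight [c] depends on adjacencies to [T] only, so that
    it never sees a replaced pair. *)
Lemma counting (c : {ffun I -> V} -> R) (L : seq (I * I)) :
  (forall z, 0 <= c z <= 1) ->
  (forall z z', (forall i, typ F T (z i) = typ F T (z' i)) -> c z = c z') ->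
  uniq L -> (forall e, e \in L -> e.1 != e.2 /\ (e.2, e.1) \notin L) ->
  avg (fun z => c z * \prod_(e <- L) agree_dens e z) <=
  avg (fun z => c z * \prod_(e <- L) agree e z) + (size L)%:R * theta.
Proof.
move=> c01 cT uL antiL.
pose mixed L1 L2 z := c z * (\prod_(e <- L1) agree_dens e z * \prod_(e <- L2) agree e z).
suff gen L2 L1 : L1 ++ L2 = L ->
    avg (mixed L [::]) <= avg (mixed L1 L2) + (size L2)%:R * theta.
  have := gen L [::] erefl; congr (_ <= _ + _); apply: eq_avg => z.
    by rewrite /mixed big_nil mulr1.
  by rewrite /mixed big_nil mul1r.
elim: L2 L1 => [|e L2 IH] L1 L12; first by rewrite mul0r addr0 -L12 cats0.
have {}IH := IH (rcons L1 e); rewrite cat_rcons in IH; move/IH: (L12) => {}IH.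
apply: le_trans IH _; rewrite -natr1 /=.
rewrite -subr_ge0.
pose h z := mixed L1 L2 z.
have eL : e \in L by rewrite -L12 mem_cat inE eqxx orbT.
have [ee eN] := antiL _ eL.
have e'N e' : e' \in L1 ++ L2 -> [/\ e' != e, e' != (e.2, e.1) & e'.1 != e'.2].
  move=> e'L12; have e'L : e' \in L.
    by rewrite -L12; move: e'L12; rewrite !mem_cat inE => /orP[->|->]; rewrite ?orbT.
  split; last by have [] := antiL _ e'L.
    apply: contraTneq e'L12 => ->; move: uL; rewrite -L12 cat_uniq mem_cat /=.
    by case/and3P=> _; rewrite !negb_or => /andP[-> _] /andP[-> _].
  by apply: contraNneq eN => <-.
have h01 z : 0 <= h z <= 1.
  have /andP[c0 c1] := c01 z.
  have p0 : 0 <= \prod_(e <- L1) agree_dens e z <= 1.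
    by apply/andP; split; [apply: prodr_ge0|apply: prodr_ile1] => e' _;
       have /andP[a0 a1] := agree_dens01 e' z; rewrite ?a0 ?a1.
  have p1 : 0 <= \prod_(e <- L2) agree e z <= 1.
    by apply/andP; split; [apply: prodr_ge0|apply: prodr_ile1] => e' _;
       have /andP[a0 a1] := agree01 e' z; rewrite ?a0 ?a1.
  move: p0 p1 => /andP[? ?] /andP[? ?]; rewrite /h /mixed !mulr_ge0 //=.
  by rewrite !mulr_ile1 ?mulr_ge0.
have := replace_one ee h01.
have -> : avg (fun z => agree e z * h z) = avg (mixed L1 (e :: L2)).
  by apply: eq_avg => z; rewrite /h /mixed big_cons; ring.
have -> : avg (fun z => agree_dens e z * h z) = avg (mixed (rcons L1 e) L2).
  by apply: eq_avg => z; rewrite /h /mixed -cats1 big_cat big_seq1 /=; ring.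
set X := avg _; set Y := avg _ => XY.
suff : `|X - Y| <= theta by rewrite ler_norml => /andP[? ?]; lra.
apply: XY => z uv uv'; set S := imset _ _ => -[].
set zu := overwrite2 _ _ z uv; set zu' := overwrite2 _ _ z uv' => e1 e2.
have zt i : typ F (T :|: S) (zu i) = typ F (T :|: S) (zu' i).
  by rewrite !ffunE; case: ifP => // _; case: ifP.
have zT i : typ F T (zu i) = typ F T (zu' i).
  exact: typ_sub (finset.subsetUl T S) (zt i).
have zS i : i != e.1 -> i != e.2 -> zu i = z i /\ zu' i = z i.
  by move=> /negPf i1 /negPf i2; rewrite !ffunE i1 i2.
have zinS i : i != e.1 -> i != e.2 -> z i \in T :|: S.
  by move=> i1 i2; rewrite inE; apply/orP; right; apply: imset_f; rewrite inE i1.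
have half i j : j != e.1 -> j != e.2 -> F (zu i) (zu j) = F (zu' i) (zu' j).
  move=> j1 j2; have [-> ->] := zS j j1 j2.
  exact: typ_adj (zinS j j1 j2) (zt i).
rewrite /h /mixed (cT zu zu') //; congr (_ * (_ * _)); apply: eq_big_seq => e' e'L.
  by rewrite /agree_dens (dens_typ R (zT e'.1) (zT e'.2)).
have [] := e'N e'; first by rewrite mem_cat e'L orbT.
rewrite /agree => n1 n2 n3; congr ((_ == _)%:R).
have [j1|j1] := eqVneq e'.2 e.1; last first.
  have [j2|j2] := eqVneq e'.2 e.2; last exact: half.
  have i2 : e'.1 != e.2 by rewrite -j2.
  have i1 : e'.1 != e.1.
    by apply: contraNneq n1 => i1; case: (e') (e) i1 j2 => ? ? [? ?] /= -> ->.
  by rewrite Fsym [RHS]Fsym half.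
have i1 : e'.1 != e.1 by rewrite -j1.
have i2 : e'.1 != e.2.
  by apply: contraNneq n2 => i2; case: (e') (e) i2 j1 => ? ? [? ?] /= -> ->.
by rewrite Fsym [RHS]Fsym half.
Qed.

End Telescope.
End Counting.

(** * Blow-ups of frequent patterns *)

Section Blowup.
Local Open Scope set_scope.
Variables (R : realFieldType) (V : finType).

Lemma avg_ffun_prod (S : finType) (g : S -> V -> R) :
  avg (fun w : {ffun S -> V} => \prod_a g a (w a)) = \prod_a avg (g a).
Proof.
rewrite /avg -bigA_distr_bigA big_split /= prodr_const; congr (_ * _).
by rewrite card_ffun natrX exprVn.
Qed.

Lemma avg_ffun_coord (S : finType) (g : V -> R) (a0 : S) : (0 < #|V|)%N ->
  avg (fun w : {ffun S -> V} => g (w a0)) = avg g.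
Proof.
move=> V0; rewrite (eq_avg (g := fun w : {ffun S -> V} =>
  \prod_a (if a == a0 then g (w a) else 1))); last first.
  by move=> w; rewrite -big_mkcond big_pred1_eq.
rewrite (avg_ffun_prod (fun a u => if a == a0 then g u else 1)) (bigD1 a0) //=.
rewrite big1 ?mulr1 => [|a /negPf aa0]; first by rewrite eqxx.
by rewrite aa0 avg_cst.
Qed.

Variables (C : eqType) (col : V -> V -> C) (k s : nat).
Variable pat : 'I_k -> 'I_k -> C.
Hypothesis V0 : (0 < #|V|)%N.
Notation I := ('I_k * 'I_s.+1)%type.
Implicit Types (z : {ffun I -> V}) (D : {set I}).

Definition fits D z : bool :=
  [forall x in D, forall y in D, (x.1 != y.1) ==> (col (z x) (z y) == pat x.1 y.1)].

(** The vertices in use after the first [j] rows have been blown up: the later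
    rows are still represented by their vertex of index [ord0]. *)
Definition stage (j : nat) : {set I} := [set x : I | (x.1 < j)%N || (x.2 == ord0)].

Definition overwrite_row (j : 'I_k) z (w : {ffun 'I_s.+1 -> V}) : {ffun I -> V} :=
  [ffun x => if x.1 == j then w x.2 else z x].

Lemma avg_overwrite_row j (f : {ffun I -> V} -> R) :
  avg f = avg (fun z => avg (fun w => f (overwrite_row j z w))).
Proof.
apply: (avg_resample (get := fun z => [ffun a => z (j, a)])).
- by rewrite card_ffun expn_gt0 V0.
- by move=> z w; apply/ffunP => a; rewrite !ffunE eqxx.
- by move=> z w w'; apply/ffunP => -[i a]; rewrite !ffunE /=; case: eqP.
- by move=> z; apply/ffunP => -[i a]; rewrite !ffunE /=; case: eqP => [->|].
Qed.

(** One step of the Erdos argument for blow-ups: given the vertices outside row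
    [j], the vertices of row [j] are independent, so that [s.+1] copies instead of
    one raise the conditional probability to the power [s.+1]; by convexity the
    mean of the powers is at least the power of the mean. *)
Lemma blowup_step (j : 'I_k) :
  avg (fun z => (fits (stage j) z)%:R : R) ^+ s.+1 <=
  avg (fun z => (fits (stage j.+1) z)%:R).
Proof.
pose D := [set x in stage j | x.1 != j].
pose ok z u := [forall x in D,
  (col u (z x) == pat j x.1) && (col (z x) u == pat x.1 j)].
have stage_row a : ((j, a) \in stage j) = (a == ord0) by rewrite inE ltnn.
have stage_rowS a : (j, a) \in stage j.+1 by rewrite inE leqnn.
have stageD (x : I) : x.1 != j -> ((x \in stage j) = (x \in D)) * ((x \in stage j.+1) = (x \in D)).
  move=> xj; have /negPf xj' : (x.1 : nat) != j.
    by apply: contraNneq xj => /val_inj ->.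
  by rewrite !inE xj andbT ltnS (leq_eqVlt x.1) xj'.
have split_fits D' (P : pred 'I_s.+1) z w : (forall a, ((j, a) \in D') = P a) ->
    (forall x : I, x.1 != j -> (x \in D') = (x \in D)) ->
    fits D' (overwrite_row j z w) = fits D z && [forall a, P a ==> ok z (w a)].
  move=> rowP offP; have DD' x : x \in D -> x \in D' /\ x.1 != j.
    by move=> xD; have := xD; rewrite inE => /andP[_ xj]; rewrite offP.
  apply/idP/andP => [/'forall_in_'forall_implyP fz|].
    have {}fz x y : x \in D' -> y \in D' -> x.1 != y.1 ->
        col (overwrite_row j z w x) (overwrite_row j z w y) = pat x.1 y.1.
      by move=> xD yD xy; have := fz x xD y yD => /implyP/(_ xy)/eqP.
    split.
      apply/'forall_in_'forall_implyP => x /DD'[xD xj] y /DD'[yD yj].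
      apply/implyP => xy; have := fz x y xD yD xy.
      by rewrite !ffunE (negPf xj) (negPf yj) => ->.
    apply/'forall_implyP => a Pa; apply/'forall_implyP => x /DD'[xD xj].
    have aD : (j, a) \in D' by rewrite rowP.
    have := fz (j, a) x aD xD; rewrite eq_sym /= => /(_ xj).
    have := fz x (j, a) xD aD xj; rewrite !ffunE /= eqxx (negPf xj) => -> ->.
    by rewrite !eqxx.
  move=> [/'forall_in_'forall_implyP fz /'forall_implyP okz].
  apply/'forall_in_'forall_implyP => -[i a] xD [i' b] yD; apply/implyP => /= xy.
  rewrite !ffunE /=; have [ij|ij] := eqVneq i j.
    subst i; have Pa : P a by rewrite -rowP.
    have /'forall_implyP/(_ (i', b)) := okz a Pa.
    by rewrite eq_sym in xy; rewrite -offP // => /(_ yD) /andP[]; rewrite (negPf xy).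
  have [i'j|i'j] := eqVneq i' j.
    subst i'; have Pb : P b by rewrite -rowP.
    by have /'forall_implyP/(_ (i, a)) := okz b Pb; rewrite -offP // => /(_ xD) /andP[].
  have := fz (i, a); rewrite -offP // => /(_ xD (i', b)).
  by rewrite -offP // => /(_ yD) /implyP; exact.
pose phi z := avg (fun u => (ok z u)%:R : R).
have -> : avg (fun z => (fits (stage j) z)%:R : R) = avg (fun z => (fits D z)%:R * phi z).
  rewrite (avg_overwrite_row j); apply: eq_avg => z.
  rewrite /phi -(avg_ffun_coord (fun u => (ok z u)%:R) (ord0 : 'I_s.+1)) // -avgZ.
  apply: eq_avg => w; rewrite (split_fits _ (pred1 ord0)) => [||x xj]; last 2 first.
  - by move=> a; rewrite stage_row.
  - by rewrite stageD.
  rewrite -natrM mulnb; congr ((_ && _)%:R).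
  apply/idP/idP => [/'forall_implyP okw|okw].
    exact: (okw _ (eqxx _)).
  by apply/fintype.forallP => a; apply/implyP => /eqP ->.
have -> : avg (fun z => (fits (stage j.+1) z)%:R : R) =
    avg (fun z => (fits D z)%:R * phi z ^+ s.+1).
  rewrite (avg_overwrite_row j); apply: eq_avg => z.
  rewrite (_ : phi z ^+ s.+1 = \prod_(a < s.+1) phi z); last first.
    by rewrite prodr_const card_ord.
  rewrite -(avg_ffun_prod (fun (_ : 'I_s.+1) u => (ok z u)%:R)) -avgZ.
  apply: eq_avg => w; rewrite (split_fits _ predT) => [||x xj]; last 2 first.
  - by move=> a; rewrite stage_rowS.
  - by rewrite stageD.
  rewrite -mulnb natrM; congr (_ * _).
  have [/fintype.forallP okw|/forallPn[a]] := boolP [forall a, predT a ==> ok z (w a)].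
    by rewrite big1 // => a _; have := okw a; rewrite /= => ->.
  by rewrite /= => /negPf okw; rewrite (bigD1 a) //= okw mul0r.
have phi0 z : 0 <= phi z by apply: avg_ge0 => u; rewrite ler0n.
apply: le_trans (avg_power _ _) _ => [z|]; first by rewrite mulr_ge0 ?ler0n.
by apply: avg_le => z; rewrite exprMn; case: fits; rewrite ?expr1n // expr0n !mul0r.
Qed.

Lemma blowup (eta : R) : 0 <= eta ->
  eta <= avg (fun z => (fits (stage 0) z)%:R) ->
  eta ^+ (s.+1 ^ k) <= avg (fun z => (fits (finset.setT) z)%:R).
Proof.
move=> eta0 etaP.
suff gen j : (j <= k)%N -> eta ^+ (s.+1 ^ j) <= avg (fun z => (fits (stage j) z)%:R).
  suff <- : stage k = finset.setT by exact: gen.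
  by apply/setP => x; rewrite !inE ltn_ord.
elim: j => [_|j IH jk]; first by rewrite expn0 expr1.
rewrite expnSr exprM; apply: le_trans (blowup_step (Ordinal jk)).
by rewrite lerXn2r ?nnegrE ?exprn_ge0 // ?IH 1?ltnW // avg_ge0 // => z; rewrite ler0n.
Qed.

End Blowup.

(** * Averaging arguments *)

Section Pigeonhole.
Variables (R : realFieldType) (Z P : finType).

Lemma pigeonhole (E : pred Z) (f : Z -> P) (eta : R) : 0 < eta ->
  eta <= avg (fun z => (E z)%:R) ->
  exists y, eta / #|P|%:R <= avg (fun z => (E z && (f z == y))%:R).
Proof.
move=> eta0 etaE; apply: contrapT => /forallNP nP.
have {}nP y : avg (fun z => (E z && (f z == y))%:R) < eta / #|P|%:R.
  by rewrite ltNge; apply/negP.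
have ez : avg (fun z => (E z)%:R) = \sum_y avg (fun z => (E z && (f z == y))%:R) :> R.
  rewrite -avg_sum; apply: eq_avg => z; rewrite (bigD1 (f z)) //= eqxx andbT.
  by rewrite big1 ?addr0 // => y; rewrite eq_sym => /negPf ->; rewrite andbF.
have [P0|P0] := posnP #|P|.
  have := lt_le_trans eta0 etaE; rewrite ez big1 ?ltxx // => y _.
  by have := fintype0 y P0.
have : \sum_y avg (fun z => (E z && (f z == y))%:R) < \sum_(y : P) eta / #|P|%:R.
  have /card_gt0P[y0 _] := P0; rewrite (bigD1 y0) //= [ltRHS](bigD1 y0) //=.
  by apply: ltr_leD => //; apply: ler_sum => y _; exact: ltW.
rewrite -ez sumr_const -[ltRHS]mulr_natr divfK ?pnatr_eq0 -?lt0n //.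
by rewrite ltNge etaE.
Qed.

(** Markov's inequality, read as a lower bound on how often [X] does not exceed its
    mean by more than [eps]. *)
Lemma below_average_often (X : Z -> R) (c eps : R) : (0 < #|Z|)%N ->
  (forall z, 0 <= X z) -> 0 < eps -> 0 <= c -> avg X <= c ->
  eps / (c + eps) <= avg (fun z => (X z <= c + eps)%R%:R).
Proof.
move=> Z0 X0 e0 c0 Xc; have ce : 0 < c + eps by lra.
have : (c + eps) * avg (fun z => 1 - (X z <= c + eps)%R%:R) <= avg X.
  rewrite -avgZ; apply: avg_le => z; case: (leP (X z)) => h /=.
    by rewrite subrr mulr0.
  by rewrite subr0 mulr1 ltW.
rewrite avgB avg_cst // ler_pdivrMr //; set m := avg _; nra.
Qed.

End Pigeonhole.

(** * Ramsey's theorem *)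

Section Ramsey.
Local Open Scope set_scope.

Definition homogeneous (V : finType) (c : rel V) (b : bool) (B : {set V}) :=
  forall x y, x \in B -> y \in B -> x != y -> c x y = b.

(** The usual induction on [a] and [b]: one of the two color classes of a vertex
    [x] is large, and [x] extends a homogeneous set found in it. *)
Lemma ramsey a b : exists N, forall (V : finType) (c : rel V) (A : {set V}),
  symmetric c -> (N <= #|A|)%N ->
  exists2 B : {set V}, B \subset A &
    (#|B| = a /\ homogeneous c true B) \/ (#|B| = b /\ homogeneous c false B).
Proof.
elim: a b => [|a IHa] b.
  exists 0%N => V c A _ _; exists finset.set0; rewrite ?finset.sub0set //.
  by left; rewrite cards0; split=> // x y; rewrite inE.
elim: b => [|b [N2 IHb]].
  exists 0%N => V c A _ _; exists finset.set0; rewrite ?finset.sub0set //.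
  by right; rewrite cards0; split=> // x y; rewrite inE.
have [N1 {}IHa] := IHa b.+1; exists (N1 + N2).+1 => V c A csym NA.
have /card_gt0P[x xA] : (0 < #|A|)%N by exact: leq_trans NA.
pose A' (d : bool) := [set y in A | (y != x) && (c x y == d)].
have A'A d : A' d \subset A by apply/fintype.subsetP => y; rewrite inE => /andP[].
have cardA : (#|A| <= (#|A' true| + #|A' false|).+1)%N.
  rewrite (cardsD1 x) xA add1n ltnS; apply: leq_trans (leq_card_setU _ _).
  apply: subset_leq_card; apply/fintype.subsetP => y; rewrite !inE => /andP[-> ->].
  by case: (c x y).
have extend d (B : {set V}) m : B \subset A' d -> #|B| = m -> homogeneous c d B ->
    [/\ x |: B \subset A, #|x |: B| = m.+1 & homogeneous c d (x |: B)].
  move=> BA Bm hB; have BP y : y \in B -> [/\ y \in A, y != x & c x y = d].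
    by move=> /(fintype.subsetP BA); rewrite inE => /and3P[? ? /eqP].
  split.
  - apply/fintype.subsetP => y /setU1P[->//|/BP[]//].
  - by rewrite cardsU1 Bm; case: (boolP (x \in B)) => // /BP[_ /eqP].
  move=> y z /setU1P[->|yB] /setU1P[->|zB] yz.
  - by rewrite eqxx in yz.
  - by have [] := BP z zB.
  - by rewrite csym; have [] := BP y yB.
  - exact: hB.
have [N1A|N1A] := leqP N1 #|A' true|.
  have [B BA [[Ba hB]|[Bb hB]]] := IHa V c _ csym N1A.
    by have [? ? ?] := extend _ _ _ BA Ba hB; exists (x |: B) => //; left.
  by exists B; [exact: fintype.subset_trans BA (A'A _)|right].
have N2A : (N2 <= #|A' false|)%N.
  by move: NA cardA N1A; clear; set u := #|_|; set v := #|_|; set w := #|_|; lia.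
have [B BA [[Ba hB]|[Bb hB]]] := IHb V c _ csym N2A.
  by exists B; [exact: fintype.subset_trans BA (A'A _)|left].
by have [? ? ?] := extend _ _ _ BA Bb hB; exists (x |: B) => //; right.
Qed.

Lemma ramsey_ord r : exists s, forall c : rel 'I_s.+1, symmetric c ->
  exists b, exists2 rho : 'I_r -> 'I_s.+1, injective rho &
    forall v w, v != w -> c (rho v) (rho w) = b.
Proof.
have [s rams] := ramsey r r; exists s => c csym.
have [|B _ hB] := rams 'I_s.+1 c finset.setT csym.
  by rewrite cardsT card_ord.
suff [b [Br {}hB]] : exists b, #|B| = r /\ homogeneous c b B.
  exists b; have inj : injective (fun v : 'I_r => enum_val (cast_ord (esym Br) v)).
    by move=> v w /enum_val_inj/cast_ord_inj.
  exists (fun v => enum_val (cast_ord (esym Br) v)) => // v w vw.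
  by apply: hB; rewrite ?enum_valP // (inj_eq inj).
by case: hB => [] [? ?]; [exists true|exists false].
Qed.

End Ramsey.

(** * Discrepancy and the cost of a coloring by densities *)

Section Cost.
Local Open Scope set_scope.
Variables (R : realFieldType) (V : finType) (F G : rel V) (p delta gamma : R).

Definition low_discrepancy := forall A B : {set V},
  `|\sum_(x in A) \sum_(y in B) ((G x y)%:R - p)| <= gamma * #|V|%:R ^+ 2.

Definition mismatch : R := avg (fun xy : V * V => (F xy.1 xy.2 != G xy.1 xy.2)%:R).

(** A pair of booleans [(can be a non-edge, can be an edge)]; white, gray and
    black are [(true, false)], [(true, true)] and [(false, true)]. *)
Definition allows (c : bool * bool) (b : bool) := if b then c.2 else c.1.
Definition color (T : {set V}) (x y : V) : bool * bool :=
  (dens R F T (x, y) <= 1 - delta, delta <= dens R F T (x, y)).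
Definition weight (c : bool * bool) : R :=
  p * (~~ c.2)%:R + (1 - p) * (~~ c.1)%:R.

Hypothesis gamma0 : 0 <= gamma.
Hypothesis discG : low_discrepancy.

(** The first coordinate has at most [2 ^ #|T|] types, and for each of them the
    sum runs over a product of two vertex sets. *)
Lemma low_discrepancy_typ T (h : V -> V -> bool) :
  (forall x x' y, typ F T x = typ F T x' -> h x y = h x' y) ->
  `|avg (fun xy => ((G xy.1 xy.2)%:R - p) * (h xy.1 xy.2)%:R)| <= 2 ^+ #|T| * gamma.
Proof.
move=> hT; have [V0|V0] := posnP #|V|.
  by rewrite /avg card_prod V0 invr0 mulr0 normr0 mulr_ge0 ?exprn_ge0.
rewrite /avg normrM normfV normr_nat ler_pdivrMr; last first.
  by rewrite ltr0n card_prod muln_gt0 V0.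
rewrite -(pair_big predT predT (fun x y => ((G x y)%:R - p) * (h x y)%:R)) /=.
rewrite (partition_big (typ F T) (mem (powerset T))) /=; last first.
  by move=> x _; rewrite powersetE; apply/fintype.subsetP => y; rewrite inE => /andP[].
apply: le_trans (ler_norm_sum _ _ _) _.
rewrite (_ : _ * _ * _ = \sum_(a in powerset T) gamma * #|V|%:R ^+ 2); last first.
  rewrite sumr_const card_powerset -[RHS]mulr_natr natrX card_prod natrM; ring.
apply: ler_sum => a _.
have [/fintype.forallP noa|] := boolP [forall x, typ F T x != a].
  rewrite big_pred0 ?normr0 ?mulr_ge0 ?exprn_ge0 // => x.
  by rewrite (negPf (noa x)).
rewrite negb_forall => /existsP[x0]; rewrite negbK => /eqP x0a.
have := discG [set x | typ F T x == a] [set y | h x0 y].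
congr (`|_| <= _); apply: eq_big => [x|x]; rewrite inE // => /eqP xa.
rewrite big_mkcond; apply: eq_bigr => y _; rewrite inE -(hT x x0) ?xa //.
by case: (h x y); rewrite ?mulr1 ?mulr0.
Qed.

(** On a white pair of classes [F] has density below [delta] and [G] has density
    about [p], so that they disagree on a proportion of at least about
    [p - delta]; on a black one, of at least about [1 - p - delta]. *)
Lemma avg_weight_le T : 0 <= delta -> delta <= 2^-1 -> 0 <= p <= 1 ->
  avg (fun xy => weight (color T xy.1 xy.2)) <=
  mismatch + delta + 2 ^+ #|T|.+1 * gamma.
Proof.
move=> d0 d2 /andP[p0 p1].
pose wh x y := ~~ (color T x y).2; pose bl x y := ~~ (color T x y).1.
have densT x y x' y' : typ F T x = typ F T x' -> typ F T y = typ F T y' ->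
    color T x y = color T x' y'.
  by move=> xx' yy'; rewrite /color (dens_typ R xx' yy').
have dw := @low_discrepancy_typ T wh _; have db := @low_discrepancy_typ T bl _.
have {}dw : `|avg (fun xy => ((G xy.1 xy.2)%:R - p) * (wh xy.1 xy.2)%:R)| <= 2 ^+ #|T| * gamma.
  by apply: dw => x x' y xx'; rewrite /wh (densT x y x' y).
have {}db : `|avg (fun xy => ((G xy.1 xy.2)%:R - p) * (bl xy.1 xy.2)%:R)| <= 2 ^+ #|T| * gamma.
  by apply: db => x x' y xx'; rewrite /bl (densT x y x' y).
have cond (h : rel V) : (forall x y x' y', typ F T x = typ F T x' -> typ F T y = typ F T y' ->
      h x y = h x' y') ->
    avg (fun xy => (F xy.1 xy.2)%:R * (h xy.1 xy.2)%:R) =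
    avg (fun xy => dens R F T xy * (h xy.1 xy.2)%:R).
  move=> hT; rewrite [LHS](avg_condavg (pi := typ2 F T) (fun xy => (F xy.1 xy.2)%:R)
    (h := fun xy => (h xy.1 xy.2)%:R)) // => -[x y] [x' y'] /= [e1 e2].
  by rewrite (hT x y x' y').
have cw := cond wh; have cb := cond bl.
have {}cw := cw (fun _ _ _ _ e1 e2 => congr1 (fun c => ~~ c.2) (densT _ _ _ _ e1 e2)).
have {}cb := cb (fun _ _ _ _ e1 e2 => congr1 (fun c => ~~ c.1) (densT _ _ _ _ e1 e2)).
pose lhs (xy : V * V) : R := (F xy.1 xy.2 != G xy.1 xy.2)%:R.
pose gw xy : R := ((G xy.1 xy.2)%:R - p) * (wh xy.1 xy.2)%:R.
pose gb xy : R := ((G xy.1 xy.2)%:R - p) * (bl xy.1 xy.2)%:R.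
pose fw xy : R := (F xy.1 xy.2)%:R * (wh xy.1 xy.2)%:R.
pose fb xy : R := (F xy.1 xy.2)%:R * (bl xy.1 xy.2)%:R.
pose qw xy : R := dens R F T xy * (wh xy.1 xy.2)%:R.
pose qb xy : R := dens R F T xy * (bl xy.1 xy.2)%:R.
(* the disagreement is at least [G - F] on a white pair, [F - G] on a black one *)
have le1 : avg (fun xy => gw xy - gb xy + (fb xy - fw xy) + p * (wh xy.1 xy.2)%:R - p * (bl xy.1 xy.2)%:R) <= avg lhs.
  apply: avg_le => -[x y]; rewrite /lhs /gw /gb /fb /fw /wh /bl /=.
  have : ~~ (delta <= dens R F T (x, y)) -> ~~ (dens R F T (x, y) <= 1 - delta) -> False.
    by rewrite -!ltNge; lra.
  case: (delta <= _); case: (_ <= 1 - delta) => /= nbot; last by case: nbot.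
  - by case: (F x y); case: (G x y); rewrite /= ?mulr0 ?mulr1 ?mul0r; lra.
  - by case: (F x y); case: (G x y); rewrite /= ?mulr0 ?mulr1 ?mul0r; lra.
  - by case: (F x y); case: (G x y); rewrite /= ?mulr0 ?mulr1 ?mul0r; lra.
have le2 : avg (fun xy => weight (color T xy.1 xy.2)) <=
    avg (fun xy => (qb xy - qw xy) + p * (wh xy.1 xy.2)%:R - p * (bl xy.1 xy.2)%:R + delta).
  apply: avg_le => -[x y]; rewrite /weight /qb /qw /wh /bl /color /=.
  by case: (leP delta (dens _ _ _ _)); case: (leP (dens _ _ _ _) (1 - delta)) => h1 h2 /=; lra.
have le3 : avg (fun _ : V * V => delta) <= delta by exact: avg_cst_le.
rewrite avgB avgD avgD avgB avgB in le1; rewrite avgD avgB avgD avgB in le2.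
have cw' : avg fw = avg qw by []; have cb' : avg fb = avg qb by [].
rewrite /mismatch -/lhs; move: dw db; rewrite !ler_norml -/gw -/gb exprS => /andP[? ?] /andP[? ?]; lra.
Qed.

End Cost.

(** * Realizable patterns in a graph *)

Section Template.
Local Open Scope set_scope.
Variable R : realType.

Lemma weight_ge0 (p : R) c : 0 <= p <= 1 -> 0 <= weight p c.
Proof. by move=> /andP[? ?]; rewrite addr_ge0 ?mulr_ge0 ?ler0n ?subr_ge0. Qed.

Lemma avg_coord2 (V I : finType) (f : V -> V -> R) (i j : I) : (0 < #|V|)%N -> i != j ->
  avg (fun z : {ffun I -> V} => f (z i) (z j)) = avg (fun uv => f uv.1 uv.2).
Proof.
move=> V0 ij; rewrite (avg_overwrite2 _ ij V0).
rewrite (eq_avg (g := fun _ => avg (fun uv => f uv.1 uv.2))).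
  by rewrite avg_cst // card_ffun expn_gt0 V0.
by move=> z; apply: eq_avg => uv; rewrite !ffunE !eqxx (eq_sym j i) (negPf ij).
Qed.

Lemma avg_collision (V I : finType) (i j : I) : (0 < #|V|)%N -> i != j ->
  avg (fun z : {ffun I -> V} => (z i == z j)%:R) = #|V|%:R^-1 :> R.
Proof.
move=> V0 ij; rewrite (avg_coord2 (fun u v => (u == v)%:R)) // avg_pair.
rewrite (eq_avg (g := fun _ => #|V|%:R^-1)) ?avg_cst // => u /=.
rewrite /avg -natr_sum -big_mkcond /= sum1_card (eq_card (B := pred1 u)).
  by rewrite card1 mul1r.
by move=> v; rewrite !inE eq_sym.
Qed.

(** The pattern [K] on [k.+1] rows of [s.+1] vertices is a blow-up of a cheap
    pattern, and all its realizations occur in [F]. Parameters are chosen in the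
    order [eta0], [eta1], [beta], [theta], [N], [gamma]: frequencies do not depend
    on the size of [T], so that stability can be required afterwards, and the
    discrepancy last. *)
Lemma template (k s : nat) (p delta : R) (I := ('I_k.+1 * 'I_s.+1)%type) :
  0 <= p <= 1 -> 0 < delta -> delta <= 2^-1 ->
  exists2 gamma : R, 0 < gamma & exists n0 : nat,
  forall (V : finType) (F G : rel V), symmetric F -> (n0 <= #|V|)%N ->
    low_discrepancy G p gamma ->
  exists K : I -> I -> bool * bool,
  [/\ (forall x y, K x y = K y x) /\ (forall x y, allows (K x y) true || allows (K x y) false),
      (forall i j a b, i != j -> K (i, a) (j, b) = K (i, ord0) (j, ord0)),
      \sum_i \sum_(j | j != i) weight p (K (i, ord0) (j, ord0)) <=
        k.+1%:R ^+ 2 * (mismatch R F G + 3 * delta) &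
      forall (L : seq (I * I)) (A : pred (I * I)),
        uniq L -> (forall e, e \in L -> e.1 != e.2 /\ (e.2, e.1) \notin L) ->
        (forall e, e \in L -> allows (K e.1 e.2) (A e)) ->
        exists z : I -> V, forall e, e \in L ->
          z e.1 != z e.2 /\ F (z e.1) (z e.2) = A e].
Proof.
move=> p01 d0 d2.
pose m := #|{: I}|; pose M := #|{: I * I}|.
pose P0 := #|{ffun 'I_k.+1 * 'I_k.+1 -> bool * bool}|.
pose P1 := #|{ffun I * I -> bool * bool}|.
have P0gt0 : 0 < P0%:R :> R by rewrite ltr0n; apply/card_gt0P; exists [ffun=> (true, true)].
have P1gt0 : 0 < P1%:R :> R by rewrite ltr0n; apply/card_gt0P; exists [ffun=> (true, true)].
(* [eta0], [eta1]: frequencies of a cheap pattern on [k.+1] vertices and of a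
   pattern on its blow-up; [beta]: frequency of each realization of the latter *)
pose eta0 := delta / 5 / P0%:R; have eta0gt0 : 0 < eta0 by rewrite !divr_gt0.
pose eta1 := eta0 ^+ (s.+1 ^ k.+1) / P1%:R.
have eta1gt0 : 0 < eta1 by rewrite divr_gt0 ?exprn_gt0.
pose beta := delta ^+ M * eta1; have beta0 : 0 < beta by rewrite mulr_gt0 ?exprn_gt0.
pose theta := beta / (4 * M.+1%:R).
have theta0 : 0 < theta by rewrite divr_gt0 // mulr_gt0 // ltr0n.
pose N := Num.bound (theta ^+ 2)^-1.
have Ntheta : 1 < N%:R * theta ^+ 2.
  by rewrite -ltr_pdivrMr ?exprn_gt0 // div1r archi_boundP // invr_ge0 exprn_ge0 ?ltW.
pose gamma := delta / 2 ^+ (N * m).+1.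
have gamma0 : 0 < gamma by rewrite divr_gt0 ?exprn_gt0.
exists gamma => //; exists (Num.bound (4 * M.+1%:R / beta)).+1 => V F G Fsym Vn0 discG.
have V0 : (0 < #|V|)%N by exact: leq_trans Vn0.
have [T Tle Tst] := stable_set_exists F m Ntheta.
have {}Tst (S : {set V}) : (#|S| <= m)%N ->
    avg (fun xy => `|dens R F (T :|: S) xy - dens R F T xy|) <= theta.
  by move=> Sm; apply: stable_close => //; exact: Tst.
pose W := avg (fun uv => weight p (color F delta T uv.1 uv.2)).
have Wle : W <= mismatch R F G + 2 * delta.
  apply: le_trans (avg_weight_le F (ltW gamma0) discG T (ltW d0) d2 p01) _.
  suff : 2 ^+ #|T|.+1 * gamma <= delta by lra.
  rewrite /gamma mulrCA ger_pMr // ler_pdivrMr ?exprn_gt0 // mul1r.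
  by rewrite ler_eXn2l ?ltr1n // ltnS.
have W0 : 0 <= W by apply: avg_ge0 => uv; exact: weight_ge0.
have mm0 : 0 <= mismatch R F G by apply: avg_ge0 => uv; rewrite ler0n.
have mm1 : mismatch R F G <= 1.
  apply: le_trans (avg_cst_le (V * V)%type ler01); apply: avg_le => uv.
  by rewrite lern1 leq_b1.
pose Z := {ffun I -> V}; have Z0 : (0 < #|{: Z}|)%N by rewrite card_ffun expn_gt0 V0.
pose col := color F delta T.
(* cost of the pattern on the representatives of the rows *)
pose X (z : Z) := (\sum_i \sum_(j | j != i) weight p (col (z (i, ord0)) (z (j, ord0)))) / k.+1%:R ^+ 2.
have X0 z : 0 <= X z.
  by rewrite divr_ge0 ?exprn_ge0 // sumr_ge0 // => i _; rewrite sumr_ge0 // => j _; exact: weight_ge0.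
have XW : avg X <= W.
  rewrite (eq_avg (g := fun z : Z => (k.+1%:R ^+ 2)^-1 *
      \sum_i \sum_(j | j != i) weight p (col (z (i, ord0)) (z (j, ord0))))); last first.
    by move=> z; rewrite mulrC.
  rewrite avgZ avg_sum mulrC ler_pdivrMr ?exprn_gt0 //.
  rewrite (_ : W * _ = \sum_(i < k.+1) \sum_(j < k.+1) W); last first.
    by rewrite !sumr_const card_ord -[RHS]mulr_natr -[X in _ = X * _]mulr_natr expr2 mulrA.
  apply: ler_sum => i _; rewrite avg_sum big_mkcond; apply: ler_sum => j _.
  case: ifP => // ji; rewrite (avg_coord2 (fun u v => weight p (col u v))) //.
  by rewrite xpair_eqE eq_sym (negPf ji).
pose c := mismatch R F G + 2 * delta.
have often : delta / 5 <= avg (fun z => (X z <= c + delta)%R%:R).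
  apply: le_trans (below_average_often Z0 X0 d0 _ (le_trans XW Wle)).
    by rewrite ler_pM2l // lef_pV2 ?posrE; rewrite /c; lra.
  by rewrite /c; lra.
pose f0 (z : Z) := [ffun ij : 'I_k.+1 * 'I_k.+1 => col (z (ij.1, ord0)) (z (ij.2, ord0))].
have [|K0 K0often] := pigeonhole f0 _ often; first by rewrite divr_gt0.
rewrite -/P0 -/eta0 in K0often.
have K0cheap : (\sum_i \sum_(j | j != i) weight p (K0 (i, j))) / k.+1%:R ^+ 2 <= c + delta.
  have [z] := avg_gt0_exists (lt_le_trans eta0gt0 K0often).
  case: (leP (X z) (c + delta)) => /= Xz; last by rewrite ltxx.
  case: eqP => [<- _|_]; last by rewrite ltxx.
  apply: le_trans Xz; rewrite /X; under eq_bigr do under eq_bigr do rewrite ffunE.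
  exact: lexx.
have fits0 : eta0 <= avg (fun z => (fits col (fun i j => K0 (i, j)) (stage k.+1 s 0) z)%:R).
  apply: le_trans K0often _; apply: avg_le => z; rewrite ler_nat.
  case: (_ <= _) => //=; case: eqP => //= <-; rewrite lt0b.
  apply/'forall_in_'forall_implyP => -[i a]; rewrite inE /= => /eqP -> [j b].
  by rewrite inE /= => /eqP ->; apply/implyP; rewrite ffunE.
have := blowup V0 (ltW eta0gt0) fits0; set fitsT := fits _ _ _ => fitsTP.
pose f1 (z : Z) := [ffun xy : I * I => col (z xy.1) (z xy.2)].
have [|K1 K1often] := pigeonhole f1 _ fitsTP; first by rewrite exprn_gt0.
rewrite -/P1 -/eta1 in K1often.
have [z1 z1P] := avg_gt0_exists (lt_le_trans eta1gt0 K1often).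
have {z1P} /andP[z1fits /eqP z1K1] : fitsT z1 && (f1 z1 == K1).
  by move: z1P; case: (_ && _); rewrite ?ltxx.
have K1E x y : K1 (x, y) = col (z1 x) (z1 y) by rewrite -z1K1 ffunE.
have K1K0 i j a b : i != j -> K1 ((i, a), (j, b)) = K0 (i, j).
  move=> ij; rewrite K1E; move/'forall_in_'forall_implyP: z1fits => /(_ (i, a)).
  by rewrite inE => /(_ isT (j, b)); rewrite inE => /(_ isT) /implyP/(_ ij)/eqP.
have allowsE b u v : allows (col u v) b ->
    delta <= if b then dens R F T (u, v) else 1 - dens R F T (u, v).
  by case: b; rewrite /allows /col /color /=; lra.
exists (fun x y => K1 (x, y)); split.
- split=> x y; rewrite !K1E.
    by rewrite /col /color dens_sym.
  by rewrite /allows /col /color /=; case: leP => //=; case: leP => //=; lra.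
- by move=> i j a b ij; rewrite !K1K0.
- rewrite mulrC -ler_pdivrMr ?exprn_gt0 //; apply: le_trans (_ : c + delta <= _).
    apply: le_trans K0cheap; under eq_bigr => i _ do under eq_bigr => j ji do
      rewrite K1K0 1?eq_sym //.
    exact: lexx.
  by rewrite /c; lra.
move=> L A uL antiL LA.
pose cc (z : Z) : R := (fitsT z && (f1 z == K1))%:R.
have cc01 z : 0 <= cc z <= 1 by rewrite ler0n lern1 leq_b1.
have colT (z z' : Z) : (forall x, typ F T (z x) = typ F T (z' x)) ->
    forall x y, col (z x) (z y) = col (z' x) (z' y).
  by move=> zz' x y; rewrite /col /color (dens_typ R (zz' x) (zz' y)).
have ccT (z z' : Z) : (forall x, typ F T (z x) = typ F T (z' x)) -> cc z = cc z'.
  move=> /colT zz'; rewrite /cc.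
  have -> : f1 z = f1 z' by apply/ffunP => xy; rewrite !ffunE zz'.
  have -> // : fitsT z = fitsT z'.
  apply: eq_forallb => x; apply: implyb_id2l => _.
  by apply: eq_forallb => y; rewrite zz'.
have Ledge : (size L <= M)%N by rewrite -(card_uniqP uL) max_card.
(* a realization has positive frequency, even after discounting the samples that
   repeat a vertex *)
have := counting Fsym A V0 (ltW theta0) Tst cc01 ccT uL antiL.
set lhs := avg _; set rhs := avg _ => cnt.
have lhsP : beta <= lhs.
  rewrite /beta mulrC; apply: (@le_trans _ _ (avg (fun z : Z => delta ^+ M * cc z))).
    by rewrite avgZ mulrC ler_wpM2l // exprn_ge0 // ltW.
  apply: avg_le => z; rewrite /cc; case: (boolP (_ && _)) => [/andP[_ /eqP zK1]|_]; last first.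
    by rewrite mulr0 mul0r.
  rewrite mulr1 mul1r; apply: (@le_trans _ _ (delta ^+ size L)).
    by apply: ler_wiXn2l => //; [exact: ltW|rewrite (le_trans d2) // invf_le1 // ler1n].
  rewrite (_ : delta ^+ size L = \prod_(e <- L) delta); last first.
    by rewrite big_const_seq count_predT iter_mulr_1.
  rewrite !big_seq; apply: ler_prod => e eL; rewrite ltW //=.
  by have := allowsE _ _ _ (_ : allows (col (z e.1) (z e.2)) (A e)); apply;
    have := LA e eL; rewrite -zK1 ffunE.
pose coll (z : Z) : R := \sum_(e in L) (z e.1 == z e.2)%:R.
have collP : avg coll <= M%:R / #|V|%:R.
  rewrite /coll avg_sum (eq_bigr (fun _ => #|V|%:R^-1)); last first.
    by move=> e /antiL[e12 _]; rewrite avg_collision.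
  by rewrite sumr_const -[leLHS]mulr_natl ler_wpM2r ?invr_ge0 ?ler0n // ler_nat max_card.
have collV : M%:R / #|V|%:R < beta / 4.
  have n0V : 4 * M.+1%:R / beta < #|V|%:R.
    apply: lt_le_trans (archi_boundP _) _; 
      first by apply: divr_ge0; [apply: mulr_ge0; exact: ler0n|exact: ltW].
    by rewrite ler_nat ltnW.
  have MM : M%:R < M.+1%:R :> R by rewrite ltr_nat.
  move: n0V; rewrite !ltr_pdivrMr ?ltr0n //; lra.
have sLtheta : (size L)%:R * theta <= beta / 4.
  apply: (@le_trans _ _ (M.+1%:R * theta)).
    by rewrite ler_pM2r // ler_nat (leq_trans Ledge).
  have : M.+1%:R != 0 :> R by rewrite pnatr_eq0.
  rewrite /theta; set u := M.+1%:R => u0; rewrite le_eqVlt; apply/orP; left; apply/eqP.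
  by field.
have : 0 < avg (fun z => cc z * \prod_(e <- L) agree R F A e z - coll z).
  rewrite avgB -/rhs; lra.
case/avg_gt0_exists => z zP; exists z => e eL.
have coll1 e' : e' \in L -> (z e'.1 == z e'.2)%:R <= coll z.
  by move=> e'L; rewrite /coll (bigD1 e') //= lerDl sumr_ge0 // => ? _; rewrite ler0n.
have prod1 : cc z * \prod_(e <- L) agree R F A e z <= 1.
  have /andP[c0 c1] := cc01 z; rewrite mulr_ile1 ?prodr_ge0 ?prodr_ile1 // => e' _;
  by have /andP[a0 a1] := agree01 R F A e' z; rewrite ?a0 ?a1.
split.
  by apply: contraTN zP => ecoll; have := coll1 e eL; rewrite ecoll /= -leNgt => ?; lra.
apply/eqP; apply: contraTT zP => eA; rewrite -leNgt (big_rem e) //= {1}/agree (negPf eA).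
by rewrite mul0r mulr0 sub0r oppr_le0 sumr_ge0 // => ? _; rewrite ler0n.
Qed.

End Template.

(** * Graphs and colored regularity graphs *)

Section GraphFacts.
Local Open Scope set_scope.

Lemma adjC n (G : sgraph n) u v : adj G u v = adj G v u.
Proof. by rewrite /adj finset.setUC. Qed.

Lemma adj_irrefl n (G : sgraph n) u : adj G u u = false.
Proof.
apply/negP => /(fintype.subsetP (edges_card2 G)).
by rewrite inE finset.setUid cards1.
Qed.

Lemma edge_card2 n (G : sgraph n) e : e \in edges G -> #|e| == 2%N.
Proof. by move/(fintype.subsetP (edges_card2 G)); rewrite inE. Qed.

(** The bridge between counting edges, as the definitions do, and sums over
    ordered pairs of vertices, as matrices and averages do. *)
Lemma sum_ordered_pairs (R : nzRingType) (T : finType) (h : {set T} -> R) :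
  \sum_i \sum_(j | j != i) h [set i; j] = 2 * \sum_(e : {set T} | #|e| == 2%N) h e.
Proof.
rewrite pair_big_dep /= (partition_big (fun ij => [set ij.1; ij.2])
    (fun e : {set T} => #|e| == 2%N)) /=; last first.
  by move=> [i j] /= ji; rewrite cards2 (eq_sym i) ji.
rewrite mulr_sumr; apply: eq_bigr => e /cards2P[x [y [xy ->]]].
rewrite (eq_bigr (fun _ => h [set x; y])) => [|[i j] /andP[_ /eqP ->] //].
rewrite (eq_bigl (mem [set (x, y); (y, x)])) => [|[i j]].
  by rewrite sumr_const cards2 xpair_eqE negb_and xy mulr_natl.
rewrite /= !inE !xpair_eqE; apply/andP/orP => [[ji /eqP e2]|].
  have /set2P ei : i \in [set x; y] by rewrite -e2 !inE eqxx.
  have /set2P ej : j \in [set x; y] by rewrite -e2 !inE eqxx orbT.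
  by case: ei ji => ->; case: ej => ->; rewrite ?eqxx // => _; [left|right].
by case=> /andP[/eqP -> /eqP ->]; rewrite // ?(eq_sym y) ?xy // finset.setUC.
Qed.

Lemma edit_dist_adj (R : nzRingType) n (F G : sgraph n) :
  \sum_i \sum_j (adj F i j != adj G i j)%:R = 2 * (edit_dist F G)%:R :> R.
Proof.
rewrite /edit_dist -sum1_card natr_sum.
rewrite (_ : \sum_(i in _) 1%:R = \sum_(e : {set 'I_n} | #|e| == 2%N)
    ((e \in edges F) != (e \in edges G))%:R).
  rewrite -sum_ordered_pairs; apply: eq_bigr => i _.
  rewrite (bigD1 i) //= !adj_irrefl eqxx add0r.
  by apply: eq_bigr.
under [RHS]eq_bigr do rewrite mulrb.
rewrite -big_mkcondr /=; apply: eq_bigl => e; rewrite !inE.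
have := @edge_card2 n F e; have := @edge_card2 n G e.
by case: (e \in edges F); case: (e \in edges G); rewrite /= ?andbF ?andbT //;
  do 2?[move=> /(_ isT)->|move=> _].
Qed.

Lemma nb_edges_adj (R : nzRingType) n (G : sgraph n) :
  \sum_i \sum_j (adj G i j)%:R = 2 * (nb_edges G)%:R :> R.
Proof.
rewrite /nb_edges -sum1_card natr_sum.
rewrite (_ : \sum_(i in _) 1%:R = \sum_(e : {set 'I_n} | #|e| == 2%N) (e \in edges G)%:R).
  rewrite -sum_ordered_pairs; apply: eq_bigr => i _.
  rewrite (bigD1 i) //= !adj_irrefl add0r.
  by apply: eq_bigr.
under [RHS]eq_bigr do rewrite mulrb.
rewrite -big_mkcondr /=; apply: eq_bigl => e.
by case eG: (e \in edges G); rewrite ?andbF ?andbT // (edge_card2 eG).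
Qed.

Lemma induced_eq m n (phi : 'I_m -> 'I_n) (F : sgraph n) (J : sgraph m) :
  (forall v w, v != w -> adj F (phi v) (phi w) = adj J v w) -> Defs.induced phi F = J.
Proof.
move=> FJ; apply: val_inj; apply/finset.setP => e; rewrite /= inE.
have [/cards2P[v [w [vw ->]]]|e2] := boolP (#|e| == 2%N).
  by rewrite /= imsetU1 imset_set1; exact: FJ.
by apply/esym/negbTE; apply: contra e2 => /edge_card2.
Qed.

Lemma mismatch_edit_dist (R : realFieldType) n (F G : sgraph n) :
  n%:R ^+ 2 * mismatch R (adj F) (adj G) = 2 * (edit_dist F G)%:R.
Proof.
rewrite -edit_dist_adj /mismatch /avg card_prod card_ord natrM -expr2.
rewrite -(pair_big predT predT (fun i j => (adj F i j != adj G i j)%:R)) /=.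
case: n F G => [|n] F G; first by rewrite !big_ord0 mul0r mulr0.
by rewrite mulrC divfK // expf_neq0 // pnatr_eq0.
Qed.

End GraphFacts.

Section CRG.
Local Open Scope set_scope.
Variable R : realType.
Implicit Types (K : crg) (p q : R).

Lemma sum_MK K p :
  \sum_i \sum_j MK K p i j = (crg_order K)%:R ^+ 2 * fK K p.
Proof.
have k0 : (crg_order K)%:R != 0 :> R by rewrite pnatr_eq0 -lt0n crg_order_gt0.
rewrite /fK mulrA divff ?expf_neq0 // mul1r.
under eq_bigr => i _ do rewrite (bigD1 i) //=.
rewrite big_split /=.
have -> : \sum_i MK K p i i = p * #|VW K|%:R + (1 - p) * #|VB K|%:R.
  rewrite -!sum1_card !natr_sum !mulr_sumr.
  rewrite [X in _ = X + _]big_mkcond [X in _ = _ + X]big_mkcond -big_split /=.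
  by apply: eq_bigr => i _; rewrite mxE eqxx !inE; case: vcolor; rewrite ?mulr1 ?addr0 ?add0r.
pose h (e : {set (ordinal (crg_order K))}) := match ecolor e with EWhite => p | EBlack => 1 - p | EGray => 0 end.
have -> : \sum_i \sum_(j | j != i) MK K p i j = \sum_i \sum_(j | j != i) h [set i; j].
  by apply: eq_bigr => i _; apply: eq_bigr => j ji; rewrite mxE eq_sym (negPf ji).
rewrite sum_ordered_pairs.
have -> : \sum_(e : {set 'I_(crg_order K)} | #|e| == 2%N) h e = p * #|EW K|%:R + (1 - p) * #|EB K|%:R.
  rewrite -!sum1_card !natr_sum !mulr_sumr.
  rewrite [X in _ = X + _]big_mkcond [X in _ = _ + X]big_mkcond -big_split /=.
  rewrite big_mkcond; apply: eq_bigr => e _; rewrite !inE /h; case: (_ == _) => /=; last by rewrite addr0.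
  by case: ecolor; rewrite ?mulr1 ?addr0 ?add0r.
ring.
Qed.

Lemma fK_avg K p : fK K p = (\sum_i \sum_j MK K p i j) / (crg_order K)%:R ^+ 2.
Proof.
by rewrite sum_MK mulrC mulKf // expf_neq0 // pnatr_eq0 -lt0n crg_order_gt0.
Qed.

Lemma fK_mono K p b : (forall i j, b <= MK K p i j) -> b <= fK K p.
Proof.
move=> bM; rewrite fK_avg ler_pdivlMr ?exprn_gt0 ?ltr0n ?crg_order_gt0 //.
have -> : b * (crg_order K)%:R ^+ 2 =
    \sum_(i < crg_order K) \sum_(j < crg_order K) b.
  by rewrite !sumr_const card_ord -[RHS]mulr_natr -[X in _ = X * _]mulr_natr expr2 mulrA.
by apply: ler_sum => i _; apply: ler_sum.
Qed.

Lemma MK01 K p i j : 0 <= p <= 1 -> 0 <= MK K p i j <= 1.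
Proof.
move=> /andP[p0 p1]; rewrite mxE.
by case: eqP => _; [case: vcolor|case: ecolor]; rewrite ?ler01 ?lexx ?subr_ge0 ?gerBl ?p0 ?p1.
Qed.

Lemma fK_ge0 K p : 0 <= p <= 1 -> 0 <= fK K p.
Proof. by move=> p01; apply: fK_mono => i j; have /andP[] := MK01 i j p01. Qed.

Lemma fK_lipschitz K p q : fK K p <= fK K q + `|p - q|.
Proof.
have k0 : 0 < (crg_order K)%:R ^+ 2 :> R by rewrite exprn_gt0 ?ltr0n ?crg_order_gt0.
rewrite !fK_avg -lerBlDl -mulrBl ler_pdivrMr //.
have -> : `|p - q| * (crg_order K)%:R ^+ 2 =
    \sum_(i < crg_order K) \sum_(j < crg_order K) `|p - q|.
  by rewrite !sumr_const card_ord -[RHS]mulr_natr -[X in _ = X * _]mulr_natr expr2 mulrA.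
rewrite -sumrB; apply: ler_sum => i _; rewrite -sumrB; apply: ler_sum => j _.
have h1 := ler_norm (p - q); have h2 := ler_norm (q - p); rewrite distrC in h2.
rewrite !mxE; case: eqP => _; first by case: vcolor; lra.
by case: ecolor; lra.
Qed.

End CRG.

Section LowerBound.
Local Open Scope set_scope.

Definition crg_of_tables k (vc : {ffun 'I_k.+1 -> bool})
    (ec : {ffun {set 'I_k.+1} -> option bool}) : crg :=
  @CRG k.+1 isT (fun v => if vc v then VWhite else VBlack)
    (fun e => match ec e with
              | None => EGray | Some true => EWhite | Some false => EBlack end).

(** There are finitely many CRGs on [k.+1] vertices, so one bound on the order
    of a witness serves all those that fail. *)
Lemma bounded_witness (H : graph_class) k : exists r, forall vc ec,
  (forall l (J : sgraph l), (l <= r)%N -> maps_to J (@crg_of_tables k vc ec) -> H l J) ->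
  crgs_of H (crg_of_tables vc ec).
Proof.
have /choice[w wP] : forall t : {ffun 'I_k.+1 -> bool} * {ffun {set 'I_k.+1} -> option bool},
    exists m, crgs_of H (crg_of_tables t.1 t.2) \/
      exists J : sgraph m, maps_to J (crg_of_tables t.1 t.2) /\ ~ H m J.
  move=> t; have [Ht|] := pselect (crgs_of H (crg_of_tables t.1 t.2)).
    by exists 0%N; left.
  move=> /existsNP[m] /existsNP[J] /not_implyP[[nHJ _]] /contrapT Jt.
  by exists m; right; exists J.
exists (\max_t w t) => vc ec good; have [//|[J [Jt nHJ]]] := wP (vc, ec).
by case: nHJ; apply: good Jt; exact: (leq_bigmax (F := w) (vc, ec)).
Qed.

(** The order of [K] depends on [eps] only, so that by [bounded_witness] it is
    enough that all graphs on at most [r] vertices which map to [K] lie in [H].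
    Such a graph is placed in the rows of a template, at vertices chosen by
    Ramsey's theorem: within a row either all pairs may be non-adjacent, and the
    vertex of [K] is white, or none may, so that all may be adjacent and the
    vertex is black. *)
Lemma edit_dist_lower (R : realType) (H : graph_class) (p eps : R) :
  hereditary H -> 0 <= p <= 1 -> 0 < eps ->
  exists2 gamma : R, 0 < gamma & exists n0 : nat, forall n (G F : sgraph n),
    (n0 <= n)%N -> low_discrepancy (adj G) p gamma -> H n F ->
    exists2 K, crgs_of H K &
      fK K p * n%:R ^+ 2 <= 2 * (edit_dist F G)%:R + eps * n%:R ^+ 2.
Proof.
move=> hH p01 eps0.
pose k := Num.bound (2 / eps).
(* the diagonal of [MK] accounts for at most [1 / k.+1] of [fK] *)
have keps : k.+1%:R^-1 <= eps / 2.
  rewrite -[eps / 2]invrK lef_pV2 ?posrE ?invr_gt0 ?divr_gt0 // invf_div.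
  by apply: ltW; apply: lt_le_trans (archi_boundP _) _; rewrite ?ler_nat // divr_ge0 // ltW.
pose delta := Num.min 2^-1 (eps / 6).
have d0 : 0 < delta by rewrite lt_min; apply/andP; split; lra.
have d2 : delta <= 2^-1 by rewrite ge_min lexx.
have deps : delta <= eps / 6 by rewrite ge_min lexx orbT.
have [r rP] := bounded_witness H k.
have [s sP] := ramsey_ord r.
have [gamma gamma0 [n0 templ]] := template k s p01 d0 d2.
exists gamma => //; exists n0 => n G F n0n discG HF.
have [|K [[Ksym Kall] Krow Kcost Kreal]] := templ 'I_n (adj F) (adj G) (@adjC _ F) _ discG.
  by rewrite card_ord.
have /choice[b bP] : forall i, exists b, exists2 rho : 'I_r -> 'I_s.+1,
    injective rho & forall v w, v != w -> allows (K (i, rho v) (i, rho w)) false = b.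
  move=> i; apply: (sP (fun a a' => allows (K (i, a) (i, a')) false)) => a a'.
  by rewrite Ksym.
have /choice[rho rhoP] : forall i, exists rho : 'I_r -> 'I_s.+1,
    injective rho /\ forall v w, v != w -> allows (K (i, rho v) (i, rho w)) false = b i.
  by move=> i; have [f ? ?] := bP i; exists f.
pose K0 i j := K (i, ord0) (j, ord0).
(* [ecolor] takes sets, so [K0] is read on any ordering of the two vertices *)
pose without d (e : {set 'I_k.+1}) := [exists i, [exists j,
  [&& i != j, e == [set i; j] & ~~ allows (K0 i j) d]]].
have withoutE d i j : i != j -> without d [set i; j] = ~~ allows (K0 i j) d.
  move=> ij; apply/existsP/idP => [[i' /existsP[j' /and3P[ij' /eqP e]]]|h].
    have : i \in [set i'; j'] by rewrite -e !inE eqxx.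
    have : j \in [set i'; j'] by rewrite -e !inE eqxx orbT.
    rewrite !inE => /orP[] /eqP ej /orP[] /eqP ei; subst => //.
    - by rewrite eqxx in ij.
    - by rewrite /K0 Ksym.
    - by rewrite eqxx in ij.
  by exists i; apply/existsP; exists j; rewrite ij eqxx.
pose ec := [ffun e => if without true e then Some true else
                      if without false e then Some false else None].
pose vc := [ffun i => b i].
exists (crg_of_tables vc ec).
  apply: rP => l J lr [phi [hom1 hom2]].
  pose iota (v : 'I_l) : 'I_k.+1 * 'I_s.+1 := (phi v, rho (phi v) (widen_ord lr v)).
  have iotaI : injective iota.
    move=> v w [e]; rewrite e => /(proj1 (rhoP _)) /(congr1 val) /= vw.
    exact: val_inj.
  have pairI v w v' w' : (iota v, iota w) = (iota v', iota w') -> v = v' /\ w = w'.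
    by move=> e; split; apply: iotaI; [exact: (congr1 fst e)|exact: (congr1 snd e)].
  pose A (e : ('I_k.+1 * 'I_s.+1) * ('I_k.+1 * 'I_s.+1)) :=
    [exists v, [exists w, (e == (iota v, iota w)) && adj J v w]].
  have AE v w : A (iota v, iota w) = adj J v w.
    apply/existsP/idP => [[v' /existsP[w' /andP[/eqP/pairI[-> ->]]]]//|Jvw].
    by exists v; apply/existsP; exists w; rewrite eqxx.
  pose L := [seq (iota e.1, iota e.2) | e : 'I_l * 'I_l in [pred e : 'I_l * 'I_l | (e.1 < e.2)%N]].
  have LP (v w : 'I_l) : (v < w)%N -> (iota v, iota w) \in L.
    by move=> vw; apply/fintype.imageP; exists (v, w).
  have [|e|e|x xP] := Kreal L A.
  - rewrite map_inj_uniq ?enum_uniq // => -[v w] [v' w'] /=.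
    by case/pairI => -> ->.
  - move=> /fintype.imageP[[v w]]; rewrite inE /= => vw -> /=; split.
      by rewrite (inj_eq iotaI); apply: contraTneq vw => ->; rewrite ltnn.
    apply/negP => /fintype.imageP[[v' w']]; rewrite inE /= => vw' /pairI[? ?]; subst v' w'.
    by have := ltn_trans vw vw'; rewrite ltnn.
  - move=> /fintype.imageP[[v w]]; rewrite inE /= => vw -> /=; rewrite AE.
    have vw' : v <> w by move=> e'; rewrite e' ltnn in vw.
    have rvw : widen_ord lr v != widen_ord lr w.
      by apply/eqP => /(congr1 val) /= /val_inj.
    have [_ hom] := rhoP (phi v).
    have [pvw|pvw] := eqVneq (phi v) (phi w).
      have inner : allows (K (iota v) (iota w)) false = b (phi v).
        by rewrite /iota -pvw hom.
      have [Jvw|Jvw] := boolP (adj J v w).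
        have [[_]|[]//] := hom1 v w Jvw.
        rewrite inE /= ffunE; case bv : (b _) => // _.
        by have := Kall (iota v) (iota w); rewrite inner bv orbF.
      have [[_ vwh]|[]//] := hom2 v w vw' Jvw.
      by rewrite inner; move: vwh; rewrite inE /= ffunE; case: (b _).
    have iotaK d : allows (K (iota v) (iota w)) d = ~~ without d [set phi v; phi w].
      by rewrite withoutE // negbK /K0 /iota Krow.
    rewrite iotaK.
    have [Jvw|Jvw] := boolP (adj J v w).
      have [[/eqP]|[_]] := hom1 v w Jvw; first by rewrite (negPf pvw).
      by rewrite !inE /= ffunE; case: (without true _); rewrite ?andbF.
    have [[/eqP]|[_]] := hom2 v w vw' Jvw; first by rewrite (negPf pvw).
    rewrite !inE /= ffunE; case wt : (without true _); last by case: (without false _); rewrite ?andbF.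
    have := Kall (phi v, ord0) (phi w, ord0).
    move: wt; rewrite withoutE // /K0 => /negPf ->; rewrite /= withoutE //.
    by rewrite negbK /K0 /= => ->.
  have xJ v w : v != w -> x (iota v) != x (iota w) /\
      adj F (x (iota v)) (x (iota w)) = adj J v w.
    move=> vw; have [lt|lt|/val_inj e] := ltngtP v w.
    - by have [] := xP _ (LP _ _ lt); rewrite /= AE.
    - by have [] := xP _ (LP _ _ lt); rewrite /= AE adjC eq_sym (adjC J).
    - by rewrite e eqxx in vw.
  have <- : Defs.induced (x \o iota) F = J by apply: induced_eq => v w /xJ[].
  apply: hereditary_induced HF => // v w /= vw; apply/eqP.
  by apply: contraT => /xJ[]; rewrite vw eqxx.
have n2 : 0 <= n%:R ^+ 2 :> R by rewrite exprn_ge0.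
rewrite -mismatch_edit_dist [leLHS]mulrC -[eps * _]mulrC -mulrDr ler_wpM2l //.
set K' := crg_of_tables vc ec; set mm := mismatch _ _ _ in Kcost *.
have k2 : 0 < (k.+1%:R : R) ^+ 2 by rewrite exprn_gt0.
rewrite fK_avg ler_pdivrMr //.
under eq_bigr => i _ do rewrite (bigD1 i) //=.
rewrite big_split /=.
have diag : \sum_i MK K' p i i <= k.+1%:R.
  rewrite -[X in X%:R]card_ord -sum1_card natr_sum; apply: ler_sum => i _.
  by have /andP[] := @MK01 R K' p i i p01.
have offdiag : \sum_i \sum_(j | j != i) MK K' p i j =
    \sum_i \sum_(j | j != i) weight p (K (i, ord0) (j, ord0)).
  apply: eq_bigr => i _; apply: eq_bigr => j ji.
  rewrite mxE eq_sym (negPf ji) /= ffunE !withoutE 1?eq_sym //.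
  have := Kall (i, ord0) (j, ord0); rewrite /weight /= /K0.
  by case: (K _ _) => -[] [] //= _; rewrite ?mulr0 ?mulr1 ?addr0 ?add0r.
rewrite offdiag; apply: le_trans (lerD diag Kcost) _.
rewrite [leRHS]mulrC -lerBrDr -mulrBr.
apply: (@le_trans _ _ (k.+1%:R ^+ 2 * (eps / 2))); last first.
  by apply: ler_wpM2l; [exact: ltW|lra].
rewrite expr2 -mulrA ler_peMr ?ler0n // -ler_pdivrMl ?ltr0n // mulr1.
exact: keps.
Qed.

End LowerBound.

(** * Blow-ups of colored regularity graphs *)

Section BlowupCRG.
Local Open Scope set_scope.
Variables (K : crg) (m : nat) (psi : 'I_m.+1 -> 'I_(crg_order K)).

(** Two copies of the same vertex are joined by its own color: a white class
    spans no edge and a black class spans every edge. *)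
Definition crg_blowup : crg :=
  @CRG m.+1 isT (fun x => vcolor (psi x))
    (fun e => if #|psi @: e| == 1%N then
                match [pick x in e | if vcolor (psi x) is VBlack then true else false] with
                | Some _ => EBlack | None => EWhite end
              else ecolor (psi @: e)).

Lemma ecolor_blowup (x y : 'I_(crg_order crg_blowup)) :
  ecolor [set x; y] =
  if psi x == psi y then (if vcolor (psi x) is VBlack then EBlack else EWhite)
  else ecolor [set psi x; psi y].
Proof.
rewrite /= imsetU1 imset_set1 cards2; have [e|] //= := eqVneq (psi x) (psi y).
case: pickP => [z|none].
  by rewrite !inE => /andP[/orP[]/eqP -> ]; rewrite -?e; case: vcolor.
by have := none x; rewrite !inE eqxx /=; case: vcolor.
Qed.

Lemma MK_blowup (R : realType) (p : R) x y :
  MK crg_blowup p x y = MK K p (psi x) (psi y).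
Proof.
rewrite !mxE ecolor_blowup; case: (x =P y) => [->|_]; first by rewrite eqxx.
by case: ifP => _ //; case: vcolor.
Qed.

Lemma maps_to_blowup n (J : sgraph n) : maps_to J crg_blowup -> maps_to J K.
Proof.
move=> [phi [h1 h2]]; exists (psi \o phi); split=> u v.
  move=> /h1[[e h]|[ne]] /=; first by rewrite e; left; split=> //; move: h; rewrite !inE /= e.
  rewrite !inE ecolor_blowup cards2 (introF eqP ne) /= => h.
  have [e|ne'] := eqVneq (psi (phi u)) (psi (phi v)).
    by left; split; rewrite ?inE; move: h; rewrite e eqxx; case: vcolor.
  right; split; first exact/eqP.
  by rewrite cards2 ne' /=; move: h; rewrite (negPf ne').
move=> /h2/[apply] -[[e h]|[ne]] /=; first by rewrite e; left; split=> //; move: h; rewrite !inE /= e.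
rewrite !inE ecolor_blowup cards2 (introF eqP ne) /= => h.
have [e|ne'] := eqVneq (psi (phi u)) (psi (phi v)).
  by left; split; rewrite ?inE; move: h; rewrite e eqxx; case: vcolor.
right; split; first exact/eqP.
by rewrite cards2 ne' /=; move: h; rewrite (negPf ne').
Qed.

Lemma crgs_of_blowup (H : graph_class) : crgs_of H K -> crgs_of H crg_blowup.
Proof. by move=> HK n F minF /maps_to_blowup; exact: HK. Qed.

End BlowupCRG.

(** * The upper bound *)

Section UpperBound.
Local Open Scope set_scope.
Variables (R : realType) (H : graph_class).
Arguments H : clear implicits.
Hypothesis hH : hereditary H.

(** A forbidden graph induced in [F] would map to [K] through [F]. *)
Lemma crgs_of_maps_to K n (F : sgraph n) : crgs_of H K -> maps_to F K -> H n F.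
Proof.
move=> HK [phi [h1 h2]]; apply/(hereditary_Forb F hH) => m J minJ [iota iotaI FJ].
apply: (HK m J minJ); exists (phi \o iota).
have adjJ u v : u != v -> adj J u v = adj F (iota u) (iota v).
  by move=> uv; rewrite -FJ /adj inE cards2 uv imsetU1 imset_set1.
split=> u v.
  have [->|uv] := eqVneq u v; first by rewrite adj_irrefl.
  by rewrite adjJ //; exact: h1.
by move=> /eqP uv; rewrite adjJ // => /h2; apply => /iotaI/eqP; rewrite (negPf uv).
Qed.

(** [minn] has no neutral element, so that the minimum over a finite type falls
    outside the theory of big operators on monoids. *)
Lemma bigmin_le (I : finType) (P : pred I) (d : nat) (f : I -> nat) i :
  P i -> (\big[minn/d]_(j | P j) f j <= f i)%N.
Proof.
move=> Pi; have : i \in index_enum I by rewrite mem_index_enum.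
elim: (index_enum I) => // j s IH; rewrite inE big_cons => /orP[/eqP <-|/IH le].
  by rewrite Pi geq_minl.
by case: (P j) => //; rewrite geq_min le orbT.
Qed.

Lemma Dist_le n (F G : sgraph n) : H n F -> (Dist H G <= edit_dist F G)%N.
Proof. by move=> HF; apply: bigmin_le; rewrite mem_set. Qed.

Lemma Dist_ge n (G : sgraph n) (b : R) : b <= 'C(n, 2)%:R ->
  (forall F, H n F -> b <= (edit_dist F G)%:R) -> b <= (Dist H G)%:R.
Proof.
move=> bN bF; apply: (big_ind (fun x => b <= x%:R)) => //.
  by move=> x y bx by_; rewrite /minn; case: ifP.
by move=> F; rewrite inE; exact: bF.
Qed.

(** With a blow-up of [K] on the vertex set of [G] in the role of [K], [G] is
    edited so that the identity becomes a colored homomorphism. *)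
Lemma edit_to_crg_subproof (K : crg) (G : sgraph (crg_order K)) :
  [set e : {set 'I_(crg_order K)} | (#|e| == 2%N) && match ecolor e with
     | EBlack => true | EWhite => false | EGray => e \in edges G end]
    \subset [set e : {set 'I_(crg_order K)} | #|e| == 2%N].
Proof. by apply/fintype.subsetP => e; rewrite !inE => /andP[]. Qed.

Definition edit_to_crg (K : crg) (G : sgraph (crg_order K)) : sgraph (crg_order K) :=
  SGraph (edit_to_crg_subproof G).

Lemma edit_to_crg_maps_to K (G : sgraph (crg_order K)) : maps_to (edit_to_crg G) K.
Proof.
exists id; split=> u v.
  have [->|uv] := eqVneq u v; first by rewrite adj_irrefl.
  rewrite /adj inE => /andP[c2 h]; right; split; first exact/eqP.
  by rewrite !inE c2; case: ecolor h.
move=> /eqP uv; rewrite /adj inE cards2 uv /= => h; right; split; first exact/eqP.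
by rewrite !inE cards2 uv; case: ecolor h.
Qed.

(** The matrices [MK K 1] and [MK K 0] are the indicators of white and black. *)
Lemma edit_to_crg_cost K (G : sgraph (crg_order K)) :
  2 * (edit_dist (edit_to_crg G) G)%:R = \sum_x \sum_(y | y != x)
    ((adj G x y)%:R * MK K 1 x y + (~~ adj G x y)%:R * MK K 0 x y) :> R.
Proof.
rewrite -edit_dist_adj; apply: eq_bigr => x _.
rewrite (bigD1 x) //= !adj_irrefl eqxx add0r; apply: eq_bigr => y yx.
rewrite !mxE (eq_sym x y) (negPf yx) {1}/adj inE cards2 (eq_sym x y) yx /=.
by case: ecolor; rewrite /adj; case: (_ \in _);
  rewrite /= ?subr0 ?subrr ?mul1r ?mul0r ?mulr1 ?mulr0 ?addr0 ?add0r.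
Qed.

Lemma fK_affine K (p : R) : fK K p = p * fK K 1 + (1 - p) * fK K 0.
Proof. by rewrite /fK; ring. Qed.

(** The expected cost of editing a graph to fit a uniformly random blow-up of
    [K] on its vertex set depends on its number of edges only. *)
Lemma Dist_upper K n (G : sgraph n) : crgs_of H K ->
  (Dist H G)%:R <= (nb_edges G)%:R * fK K 1 +
    ('C(n, 2)%:R - (nb_edges G)%:R) * fK K 0 :> R.
Proof.
case: n G => [|n] G HK.
  have -> : nb_edges G = 0%N.
    apply/eqP; rewrite cards_eq0 -finset.subset0; apply/fintype.subsetP => e eG.
    have := edge_card2 eG; rewrite (_ : e = finset.set0) ?cards0 //.
    by apply/finset.setP => -[].
  rewrite !mul0r add0r subr0 mul0r lern0.
  rewrite -leqn0; apply: (big_ind (fun x => x <= 0)%N) => // [x y x0 y0|F _].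
    by rewrite geq_min x0.
  rewrite leqn0 /edit_dist cards_eq0 -finset.subset0; apply/fintype.subsetP => e.
  rewrite !inE => /orP[]/andP[_ /edge_card2]; rewrite (_ : e = finset.set0) ?cards0 //;
    by apply/finset.setP => -[].
pose k := crg_order K.
have k0 : (0 < #|'I_k|)%N by rewrite card_ord crg_order_gt0.
pose cost (psi : {ffun 'I_n.+1 -> 'I_k}) : R := \sum_x \sum_(y | y != x)
  ((adj G x y)%:R * MK K 1 (psi x) (psi y) + (~~ adj G x y)%:R * MK K 0 (psi x) (psi y)).
have [psi psiP] : exists psi, cost psi <= avg cost.
  by apply: avg_exists; rewrite card_ffun expn_gt0 k0.
pose B := crg_blowup psi; pose F := @edit_to_crg B G.
have HF : H n.+1 F by apply: crgs_of_maps_to (crgs_of_blowup HK) (edit_to_crg_maps_to _).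
apply: (@le_trans _ _ (edit_dist F G)%:R); first by rewrite ler_nat Dist_le.
rewrite -(ler_pM2l (ltr0Sn _ 1)).
have -> : 2 * (edit_dist F G)%:R = cost psi.
  rewrite (@edit_to_crg_cost B G); apply: eq_bigr => x _; apply: eq_bigr => y _.
  by rewrite !MK_blowup.
apply: le_trans psiP _; rewrite avg_sum.
have avgM q : avg (fun uv : 'I_k * 'I_k => MK K q uv.1 uv.2) = fK K q.
  rewrite fK_avg /avg card_prod card_ord natrM -expr2.
  by rewrite -(pair_big predT predT (fun i j => MK K q i j)).
rewrite (eq_bigr (fun x => \sum_(y | y != x)
   ((adj G x y)%:R * fK K 1 + (~~ adj G x y)%:R * fK K 0))); last first.
  move=> x _; rewrite avg_sum; apply: eq_bigr => y yx; rewrite avgD !avgZ.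
  rewrite (avg_coord2 (fun i j => MK K 1 i j)) // 1?eq_sym //.
  rewrite (avg_coord2 (fun i j => MK K 0 i j)) // 1?eq_sym //.
  by rewrite !avgM.
pose w1 : R := fK K 1; pose w0 : R := fK K 0.
have split2 x : \sum_(y | y != x) ((adj G x y)%:R * w1 + (~~ adj G x y)%:R * w0) =
    \sum_y (adj G x y)%:R * (w1 - w0) + n%:R * w0.
  rewrite [in RHS](bigD1 x) //= adj_irrefl mul0r add0r.
  have <- : \sum_(y < n.+1 | y != x) w0 = n%:R * w0.
    rewrite sumr_const -[LHS]mulr_natl; congr (_%:R * _).
    have := cardC1 x; rewrite card_ord /= => cx; rewrite -[RHS]cx.
    by apply: eq_card => y; rewrite !inE.
  by rewrite -big_split; apply: eq_bigr => y _; case: adj => /=; ring.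
rewrite -/w1 -/w0; under eq_bigr do rewrite split2 -mulr_suml.
rewrite big_split /= -mulr_suml nb_edges_adj sumr_const card_ord -[X in _ + X <= _]mulr_natl.
have -> : n.+1%:R * (n%:R * w0) = 2 * 'C(n.+1, 2)%:R * fK K 0 :> R.
  by rewrite mulrA -!natrM -(mul_bin_diag n.+1 1) bin1.
by rewrite le_eqVlt; apply/orP; left; apply/eqP; rewrite /w1 /w0; ring.
Qed.

End UpperBound.

(** * The functions f and g *)

Section FandG.
Variables (R : realType) (H : graph_class).
Arguments H : clear implicits.
Hypothesis hH : hereditary H.
Implicit Types (p q : R).

(** The lower bound, applied to an empty graph and [p = 0], produces one. *)
Lemma crgs_of_nonempty : exists K, crgs_of H K.
Proof.
have p01 : (0 : R) <= (0 : R) <= 1 by rewrite lexx ler01.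
have [gamma gamma0 [n0 low]] := edit_dist_lower hH p01 ltr01.
have [_ _ /(_ n0)[F HF]] := hH.
have G0 : finset.set0 \subset [set e : {set 'I_n0} | #|e| == 2%N]%SET by rewrite finset.sub0set.
have [|K HK _] := low n0 (SGraph G0) F (leqnn _) _ HF; last by exists K.
move=> A B; rewrite big1 ?normr0 => [|x _].
  by apply: mulr_ge0; [exact: ltW|rewrite exprn_ge0].
by rewrite big1 // => y _; rewrite /adj inE subrr.
Qed.

Lemma fK_lbound p : has_lbound [set fK K p | K in crgs_of H].
Proof.
exists (- (`|p| + `|1 - p|)) => _ [K _ <-]; apply: fK_mono => i j.
have h1 := ler_norm (- p); have h2 := ler_norm (- (1 - p)); rewrite !normrN in h1 h2.
have h3 := normr_ge0 p; have h4 := normr_ge0 (1 - p).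
by rewrite mxE; case: eqP => _; [case: vcolor|case: ecolor]; lra.
Qed.

Lemma f_of_le K p : crgs_of H K -> f_of H p <= fK K p.
Proof. by move=> HK; apply: ge_inf; [exact: fK_lbound|exists K]. Qed.

Lemma f_of_ge p b : (forall K, crgs_of H K -> b <= fK K p) -> b <= f_of H p.
Proof.
move=> bf; apply: lb_le_inf => [|_ [K HK <-]]; last exact: bf.
by have [K HK] := crgs_of_nonempty; exists (fK K p), K.
Qed.

Lemma f_of_ge0 p : 0 <= p <= 1 -> 0 <= f_of H p.
Proof. by move=> p01; apply: f_of_ge => K _; exact: fK_ge0. Qed.

Lemma f_of_le1 p : 0 <= p <= 1 -> f_of H p <= 1.
Proof.
move=> p01; have [K HK] := crgs_of_nonempty; apply: le_trans (f_of_le p HK) _.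
rewrite fK_avg ler_pdivrMr ?exprn_gt0 ?ltr0n ?crg_order_gt0 // mul1r.
have -> : (crg_order K)%:R ^+ 2 =
    \sum_(i < crg_order K) \sum_(j < crg_order K) 1 :> R.
  by rewrite !sumr_const card_ord -[RHS]mulr_natr -[X in _ = X * _]mulr_natr expr2 mul1r.
by apply: ler_sum => i _; apply: ler_sum => j _; have /andP[] := MK01 i j p01.
Qed.

Lemma f_of_lipschitz p q : f_of H p <= f_of H q + `|p - q|.
Proof.
rewrite -lerBlDr; apply: f_of_ge => K HK; rewrite lerBlDr.
exact: le_trans (f_of_le p HK) (fK_lipschitz K p q).
Qed.

Lemma f_of_concave p q t : 0 <= t <= 1 ->
  t * f_of H p + (1 - t) * f_of H q <= f_of H (t * p + (1 - t) * q).
Proof.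
move=> /andP[t0 t1]; apply: f_of_ge => K HK.
have := f_of_le p HK; have := f_of_le q HK.
rewrite (fK_affine K p) (fK_affine K q) (fK_affine K (t * p + _)) => hq hp.
have t1' : 0 <= 1 - t by rewrite subr_ge0.
have := ler_wpM2l t0 hp; have := ler_wpM2l t1' hq; lra.
Qed.

Lemma f_of_max : exists2 p, 0 <= p <= 1 &
  forall q, 0 <= q <= 1 -> f_of H q <= f_of H p.
Proof.
have cf : continuous (f_of H : R -> R).
  move=> p; apply/cvgrPdist_le => e e0; near=> q.
  have pq : `|p - q| <= e by near: q; exact: cvgr_dist_le.
  have h1 := f_of_lipschitz p q; have h2 := f_of_lipschitz q p.
  by rewrite distrC in h2; rewrite ler_norml; lra.
have [p p01 pmax] := EVT_max (@ler01 R) (continuous_subspaceT cf).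
by exists p => [|q q01]; [move: p01; rewrite in_itv|apply: pmax; rewrite in_itv].
Unshelve. all: by end_near. Qed.

Lemma qformE K p (u : 'cV[R]_(crg_order K)) :
  qform K p u = \sum_i \sum_j u i 0 * u j 0 * MK K p i j.
Proof.
rewrite /qform mxE exchange_big /=; apply: eq_bigr => j _; rewrite mxE mulr_suml.
by apply: eq_bigr => i _; rewrite !mxE; ring.
Qed.

Lemma gK_le_fK K p : gK K p <= fK K p.
Proof.
pose k := crg_order K.
have k0 : k%:R != 0 :> R by rewrite pnatr_eq0 -lt0n crg_order_gt0.
pose u : 'cV[R]_k := const_mx k%:R^-1.
have us : simplex u.
  split=> [|i]; last by rewrite mxE invr_ge0.
  under eq_bigr do rewrite mxE.
  by rewrite sumr_const card_ord -[LHS]mulr_natr mulVf.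
have [v vs [<- /(_ u us)]] := gK_min K p; move=> h; apply: le_trans h _.
rewrite qformE fK_avg mulr_suml le_eqVlt; apply/orP; left; apply/eqP.
apply: eq_bigr => i _; rewrite mulr_suml; apply: eq_bigr => j _.
by rewrite !mxE -/k; field.
Qed.

(** If the values [psi z] are independent with distribution [u], then two of them
    at different points are a pair of independent samples. *)
Lemma weighted_pair (m k : nat) (u : 'I_k -> R) (h : 'I_k -> 'I_k -> R) (x y : 'I_m) :
  \sum_i u i = 1 -> x != y ->
  \sum_(psi : {ffun 'I_m -> 'I_k}) (\prod_z u (psi z)) * h (psi x) (psi y) =
  \sum_i \sum_j u i * u j * h i j.
Proof.
move=> u1 xy.
pose g i j z a := u a * ((z == x) ==> (a == i))%:R * ((z == y) ==> (a == j))%:R.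
transitivity (\sum_i \sum_j h i j * \sum_(psi : {ffun 'I_m -> 'I_k}) \prod_z g i j z (psi z)).
  under [RHS]eq_bigr do under eq_bigr do rewrite mulr_sumr.
  under [RHS]eq_bigr do rewrite exchange_big.
  rewrite exchange_big; apply: eq_bigr => psi _ /=.
  have prodg i j : \prod_z g i j z (psi z) =
      (\prod_z u (psi z)) * (psi x == i)%:R * (psi y == j)%:R.
    rewrite /g !big_split /=; congr (_ * _ * _).
      by rewrite (bigD1 x) //= eqxx big1 ?mulr1 // => z /negPf ->.
    by rewrite (bigD1 y) //= eqxx big1 ?mulr1 // => z /negPf ->.
  have offy : \sum_(j | j != psi y) h (psi x) j * \prod_z g (psi x) j z (psi z) = 0.
    by apply: big1 => j; rewrite eq_sym prodg => /negPf ->; rewrite !mulr0.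
  have offx : \sum_(i | i != psi x) \sum_j h i j * \prod_z g i j z (psi z) = 0.
    apply: big1 => i; rewrite eq_sym => /negPf xi; apply: big1 => j _.
    by rewrite prodg xi mulr0 mul0r mulr0.
  rewrite (bigD1 (psi x)) //= offx (bigD1 (psi y)) //= offy !addr0 prodg !eqxx !mulr1.
  by rewrite mulrC.
apply: eq_bigr => i _; apply: eq_bigr => j _; rewrite mulrC; congr (_ * _).
rewrite -(bigA_distr_bigA (g i j)) (bigD1 x) //= (bigD1 y) 1?eq_sym //=.
rewrite (bigD1 i) //= /g !eqxx (negPf xy) /= !mulr1 big1 ?addr0 => [|a /negPf ->]; last by rewrite mulr0 mul0r.
rewrite (bigD1 j) //= eq_sym (negPf xy) /= !eqxx !mulr1 big1 ?addr0 => [|a /negPf ->]; last by rewrite mulr0.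
rewrite [X in _ * (_ * X)]big1 ?mulr1 // => z /andP[/negPf zx /negPf zy].
by rewrite -[RHS]u1; apply: eq_bigr => a _; rewrite zx zy !mulr1.
Qed.

Lemma weighted_total (m k : nat) (u : 'I_k -> R) : \sum_i u i = 1 ->
  \sum_(psi : {ffun 'I_m -> 'I_k}) \prod_z u (psi z) = 1.
Proof.
by move=> u1; rewrite -(bigA_distr_bigA (fun _ => u)) big1.
Qed.

(** A random blow-up of [K] in which the classes are chosen independently with
    distribution [u] has expected [fK] at most [qform K p u + 1 / m.+1], the
    last term coming from the diagonal. *)
Lemma f_of_le_qform K p (u : 'cV[R]_(crg_order K)) : 0 <= p <= 1 ->
  crgs_of H K -> simplex u -> f_of H p <= qform K p u.
Proof.
move=> p01 HK [u1 u0]; set q := qform K p u.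
have q0 : 0 <= q.
  rewrite /q qformE; apply: sumr_ge0 => i _; apply: sumr_ge0 => j _.
  by rewrite !mulr_ge0 ?u0 //; have /andP[] := MK01 i j p01.
have bound m : f_of H p <= q + m.+1%:R^-1.
  pose w (psi : {ffun 'I_m.+1 -> 'I_(crg_order K)}) : R := \prod_z u (psi z) 0.
  have w0 psi : 0 <= w psi by apply: prodr_ge0 => z _; exact: u0.
  have w1 : \sum_psi w psi = 1 by exact: (weighted_total m.+1 u1).
  have m0 : 0 < m.+1%:R ^+ 2 :> R by rewrite exprn_gt0.
  rewrite -(ler_pM2r m0).
  have -> : f_of H p * m.+1%:R ^+ 2 = \sum_psi w psi * (f_of H p * m.+1%:R ^+ 2).
    by rewrite -mulr_suml w1 mul1r.
  apply: (@le_trans _ _ (\sum_psi w psi * \sum_x \sum_y MK K p (psi x) (psi y))).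
    apply: ler_sum => psi _; rewrite ler_wpM2l // mulrC.
    have -> : \sum_x \sum_y MK K p (psi x) (psi y) = m.+1%:R ^+ 2 * fK (crg_blowup psi) p.
      rewrite -(sum_MK (crg_blowup psi)); apply: eq_bigr => x _; apply: eq_bigr => y _.
      by rewrite MK_blowup.
    by apply: ler_wpM2l; [exact: ltW|apply: f_of_le; exact: crgs_of_blowup].
  under eq_bigr do rewrite mulr_sumr.
  rewrite exchange_big /=; under eq_bigr do (under eq_bigr do rewrite mulr_sumr).
  have -> : (q + m.+1%:R^-1) * m.+1%:R ^+ 2 =
      \sum_(x < m.+1) (1 + \sum_(y < m.+1) q).
    rewrite big_split /= !sumr_const card_ord.
    rewrite -[X in _ = X + _]mulr_natr -[X in _ = _ + X]mulr_natr -[X in _ = _ + X * _]mulr_natr.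
    have : m.+1%:R != 0 :> R by rewrite pnatr_eq0.
    by set M := m.+1%:R => M0; field.
  apply: ler_sum => x _; rewrite exchange_big /= (bigD1 x) //=; apply: lerD.
    rewrite -[leRHS]w1; apply: ler_sum => psi _; rewrite ler_piMr //.
    by have /andP[] := MK01 (psi x) (psi x) p01.
  rewrite [leRHS](bigD1 x) //= -[leLHS]add0r; apply: lerD => //.
  apply: ler_sum => y yx; rewrite (weighted_pair (fun i j => MK K p i j) u1) 1?eq_sym //.
  by rewrite /q qformE.
rewrite leNgt; apply/negP => /[dup] fq; rewrite -subr_gt0 => fq'.
have := bound (Num.bound (f_of H p - q)^-1); rewrite -lerBlDl => le_inv.
suff : (Num.bound (f_of H p - q)^-1).+1%:R^-1 < f_of H p - q.
  by move=> /(le_lt_trans le_inv); rewrite ltxx.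
rewrite -[ltRHS]invrK ltf_pV2 ?posrE ?invr_gt0 //.
by apply: lt_le_trans (archi_boundP _) _; [rewrite invr_ge0 ltW|rewrite ler_nat].
Qed.

Lemma f_of_eq_g_of p : 0 <= p <= 1 -> f_of H p = g_of H p.
Proof.
move=> p01; apply/eqP; rewrite eq_le; apply/andP; split.
  apply: lb_le_inf => [|_ [K HK <-]].
    by have [K HK] := crgs_of_nonempty; exists (gK K p), K.
  by have [u us [<- _]] := gK_min K p; exact: f_of_le_qform.
apply: f_of_ge => K HK; apply: le_trans (gK_le_fK K p).
apply: ge_inf; last by exists K.
exists (f_of H p) => _ [K' HK' <-].
by have [u us [<- _]] := gK_min K' p; exact: f_of_le_qform.
Qed.

Lemma Dist_le_f n (G : sgraph n) : (1 < n)%N ->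
  (Dist H G)%:R <= f_of H ((nb_edges G)%:R / 'C(n, 2)%:R : R) * 'C(n, 2)%:R.
Proof.
move=> n1; have N0 : 0 < 'C(n, 2)%:R :> R by rewrite ltr0n bin_gt0.
rewrite -ler_pdivrMr //; apply: f_of_ge => K HK; rewrite ler_pdivrMr //.
apply: le_trans (Dist_upper R hH G HK) _; rewrite [in leRHS]fK_affine.
rewrite le_eqVlt; apply/orP; left; apply/eqP; field.
by rewrite gt_eqF.
Qed.

End FandG.

(** * Random graphs have low discrepancy *)

Section FourCycles.
Local Open Scope set_scope.
Variables (R : realType) (n : nat).
Implicit Types (G : sgraph n) (p : R).

(** The diagonal is zero rather than [- p], so that cycles through a loop
    contribute nothing to [fourcycles]. *)
Definition centered p G (x y : 'I_n) : R := if x == y then 0 else (adj G x y)%:R - p.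

(** The density of four-cycles of the centered adjacency matrix. *)
Definition fourcycles p G : R :=
  avg (fun yy : 'I_n * 'I_n => avg (fun x => centered p G x yy.1 * centered p G x yy.2) ^+ 2).

Lemma fourcycles_ge0 p G : 0 <= fourcycles p G.
Proof. by apply: avg_ge0 => yy; rewrite sqr_ge0. Qed.

Lemma avg_sqr (T : finType) (f : T -> R) : avg f ^+ 2 <= avg (fun x => f x ^+ 2).
Proof.
apply: (@le_trans _ _ (avg (fun x => `|f x|) ^+ 2)).
  rewrite -real_normK ?num_real // lerXn2r ?nnegrE ?avg_norm //.
  by apply: avg_ge0 => x.
apply: le_trans (avg_power 1 _) _ => //.
by apply: avg_le => x; rewrite real_normK ?num_real.
Qed.

Lemma avg_mul (T : finType) (f : T -> R) :
  avg f ^+ 2 = avg (fun xx : T * T => f xx.1 * f xx.2).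
Proof.
rewrite avg_pair expr2 [in RHS](eq_avg (g := fun x => avg f * f x)) ?avgZ // => x.
by rewrite (eq_avg (g := fun y => f x * f y)) // avgZ mulrC.
Qed.

Lemma avg_exchange (S T : finType) (f : S -> T -> R) :
  avg (fun x => avg (f x)) = avg (fun y => avg (fun x => f x y)).
Proof. by rewrite /avg -!mulr_suml exchange_big mulrAC. Qed.

(** Two applications of the Cauchy-Schwarz inequality. *)
Lemma discrepancy_fourcycles p G (A B : {set 'I_n}) :
  (avg (fun x => (x \in A)%:R * avg (fun y => (y \in B)%:R * centered p G x y))) ^+ 4
  <= fourcycles p G.
Proof.
pose row x := avg (fun y => (y \in B)%:R * centered p G x y).
have half : avg (fun x => (x \in A)%:R * row x) ^+ 2 <=
    avg (fun yy : 'I_n * 'I_n => `|avg (fun x => centered p G x yy.1 * centered p G x yy.2)|).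
  apply: le_trans (avg_sqr _) _.
  apply: (@le_trans _ _ (avg (fun x => row x ^+ 2))).
    apply: avg_le => x; case: (x \in A); first by rewrite mul1r.
    by rewrite mul0r expr0n sqr_ge0.
  under [avg _]eq_avg do rewrite avg_mul.
  rewrite avg_exchange; apply: avg_le => -[y y'] /=.
  rewrite (eq_avg (g := fun x => ((y \in B)%:R * (y' \in B)%:R) *
     (centered p G x y * centered p G x y'))); last by move=> x; ring.
  rewrite avgZ; apply: le_trans (ler_norm _) _; rewrite normrM ler_piMl //.
  by case: (y \in B); case: (y' \in B); rewrite ?mulr1 ?mulr0 ?normr0 ?normr1.
rewrite (_ : 4 = 2 * 2)%N // exprM; apply: le_trans (_ : _ <= avg (fun yy : 'I_n * 'I_n =>
    `|avg (fun x => centered p G x yy.1 * centered p G x yy.2)|) ^+ 2) _.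
  by rewrite lerXn2r ?nnegrE ?sqr_ge0 // avg_ge0.
apply: le_trans (avg_sqr _) _; apply: avg_le => yy.
by rewrite real_normK ?num_real.
Qed.

(** The discrepancy of [A], [B] is that of the centered matrix plus the diagonal
    contribution [p * #|A :&: B| <= n]; each is at most [gamma / 2 * n ^ 2]. *)
Lemma low_discrepancy_fourcycles p G (gamma : R) : 0 <= p <= 1 -> 0 < gamma ->
  2 / gamma <= n%:R -> fourcycles p G <= (gamma / 2) ^+ 4 ->
  low_discrepancy (adj G) p gamma.
Proof.
move=> p01 g0 n0 small A B; rewrite card_ord.
have ngt0 : 0 < n%:R :> R by apply: lt_le_trans n0; rewrite divr_gt0.
set D := avg (fun x => (x \in A)%:R * avg (fun y => (y \in B)%:R * centered p G x y)).
have Dle : `|D| <= gamma / 2.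
  have := le_trans (discrepancy_fourcycles p G A B) small; rewrite -/D.
  have D4 : 0 <= D ^+ 4 by rewrite (exprM D 2 2) sqr_ge0.
  rewrite -(ger0_norm D4) normrX.
  by rewrite ler_pXn2r // nnegrE // divr_ge0 // ltW.
have -> : \sum_(x in A) \sum_(y in B) ((adj G x y)%:R - p) =
   n%:R ^+ 2 * D - p * (#|A :&: B|)%:R.
  rewrite /D /avg card_ord.
  have -> : n%:R ^+ 2 * ((\sum_x (x \in A)%:R * ((\sum_y (y \in B)%:R * centered p G x y) / n%:R)) / n%:R) =
     \sum_(x in A) \sum_(y in B) centered p G x y.
    rewrite [RHS]big_mkcond mulr_suml mulr_sumr; apply: eq_bigr => x _.
    case: ifP => xA; last by rewrite mul0r mul0r mulr0.
    rewrite mul1r [in RHS]big_mkcond !mulr_suml mulr_sumr; apply: eq_bigr => y _.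
    case: ifP => _; last by rewrite !mul0r mulr0.
    by rewrite mul1r; field; rewrite gt_eqF.
  rewrite -sum1_card natr_sum mulr_sumr
    [X in _ - X](eq_bigl (fun x => (x \in A) && (x \in B))); last first.
    by move=> x; rewrite inE.
  rewrite [X in _ - X]big_mkcondr -sumrB; apply: eq_bigr => x _.
  case: ifP => xB.
    rewrite (bigD1 x) //= [in RHS](bigD1 x) //= /centered eqxx add0r adj_irrefl sub0r mulr1 addrC.
    by congr (_ - _); apply: eq_bigr => y /andP[_ yx]; rewrite eq_sym (negPf yx).
  rewrite subr0; apply: eq_bigr => y yB; rewrite /centered; case: eqP => // xy.
  by rewrite xy yB in xB.
apply: le_trans (ler_normB _ _) _; rewrite normrM (ger0_norm (sqr_ge0 _)).
have ABn : `|p * (#|A :&: B|)%:R| <= n%:R.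
  have /andP[pge0 ple1] := p01; rewrite ger0_norm ?mulr_ge0 //.
  apply: (@le_trans _ _ (#|A :&: B|)%:R); first by rewrite ler_piMl.
  by rewrite ler_nat -[X in (_ <= X)%N]card_ord max_card.
have : n%:R <= gamma / 2 * n%:R ^+ 2.
  rewrite expr2 mulrA; apply: ler_peMl; first exact: ltW.
  by move: n0; rewrite ler_pdivrMr // => h; lra.
have := ler_wpM2l (ltW (exprn_gt0 2 ngt0)) Dle; lra.
Qed.

(** Averaging over the choice of the cycle: the degenerate cycles have density
    at most [2 / n], the others are controlled by [beta]. *)
Lemma mean_fourcycles p (mu : sgraph n -> R) (beta : R) : (0 < n)%N ->
  0 <= p <= 1 -> (forall G, 0 <= mu G) -> \sum_G mu G = 1 -> 0 <= beta ->
  (forall x x' y y', x != x' -> y != y' -> x != y -> x != y' -> x' != y -> x' != y' ->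
    \sum_G mu G * (((adj G x y)%:R - p) * ((adj G x y')%:R - p) *
                   (((adj G x' y)%:R - p) * ((adj G x' y')%:R - p))) <= beta) ->
  \sum_G mu G * fourcycles p G <= 2 / n%:R + beta.
Proof.
move=> n0 /andP[p0 p1] mu0 mu1 b0 mub.
pose X := centered p.
have X1 G x y : `|X G x y| <= 1.
  rewrite /X /centered; case: eqP => _; first by rewrite normr0.
  by case: adj; rewrite ler_norml /=; lra.
pose cyc G (yy xx : 'I_n * 'I_n) := (X G xx.1 yy.1 * X G xx.1 yy.2) * (X G xx.2 yy.1 * X G xx.2 yy.2).
have -> : \sum_G mu G * fourcycles p G =
    avg (fun yy => avg (fun xx => \sum_G mu G * cyc G yy xx)).
  under [RHS]eq_avg do rewrite avg_sum.
  rewrite avg_sum; apply: eq_bigr => G _; rewrite -avgZ; apply: eq_avg => yy.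
  by rewrite avg_mul avgZ.
have diag : avg (fun yy : 'I_n * 'I_n => (yy.1 == yy.2)%:R : R) = n%:R^-1.
  rewrite avg_pair (eq_avg (g := fun _ => n%:R^-1)) ?avg_cst ?card_ord // => y /=.
  rewrite /avg card_ord (bigD1 y) //= eqxx big1 ?addr0 ?mul1r // => z.
  by rewrite eq_sym => /negPf ->.
have cards : (0 < #|{: 'I_n * 'I_n}|)%N by rewrite card_prod card_ord muln_gt0 n0.
apply: (@le_trans _ _ (avg (fun yy : 'I_n * 'I_n => avg (fun xx : 'I_n * 'I_n =>
   (yy.1 == yy.2)%:R + (xx.1 == xx.2)%:R + beta)))); last first.
  rewrite (eq_avg (g := fun yy => (yy.1 == yy.2)%:R + (n%:R^-1 + beta))).
    by rewrite avgD diag avg_cst //; lra.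
  by move=> yy; rewrite avgD avgD diag !avg_cst // addrA.
apply: avg_le => -[y y']; apply: avg_le => -[x x'] /=; rewrite /cyc /=.
have cyc1 : \sum_G mu G * cyc G (y, y') (x, x') <= 1.
  rewrite -mu1; apply: ler_sum => G _; rewrite ler_piMr //.
  apply: le_trans (ler_norm _) _; rewrite !normrM.
  by rewrite !mulr_ile1 ?mulr_ge0.
have [yy'|yy'] := eqVneq y y'.
  by apply: le_trans cyc1 _; case: (x == x') => /=; lra.
have [xx'|xx'] := eqVneq x x'.
  by apply: le_trans cyc1 _ => /=; lra.
rewrite /= !add0r.
have [/and4P[xy xy' x'y x'y']|nd] := boolP [&& x != y, x != y', x' != y & x' != y'].
  apply: le_trans (mub x x' y y' xx' yy' xy xy' x'y x'y').
  by apply: ler_sum => G _; rewrite /X /centered (negPf xy) (negPf xy') (negPf x'y) (negPf x'y').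
rewrite big1 // => G _; rewrite /X /centered.
by move: nd; rewrite !negb_and !negbK => /or4P[] ->; rewrite !(mul0r, mulr0).
Qed.

Lemma markov_mass (mu f : sgraph n -> R) (A : pred (sgraph n)) (c : R) :
  (forall G, 0 <= mu G) -> \sum_G mu G = 1 -> (forall G, 0 <= f G) -> 0 < c ->
  (forall G, mu G != 0 -> f G <= c -> A G) ->
  1 - (\sum_G mu G * f G) / c <= \sum_(G | A G) mu G.
Proof.
move=> mu0 mu1 f0 c0 fA; rewrite lerBlDr -lerBlDl -mu1.
rewrite [X in X - _](bigID A) /= addrAC subrr add0r ler_pdivlMr // mulr_suml.
rewrite [leRHS](bigID A) /= -[leLHS]add0r; apply: lerD.
  by apply: sumr_ge0 => G _; exact: mulr_ge0.
apply: ler_sum => G nA; have [->|m0] := eqVneq (mu G) 0; first by rewrite !mul0r.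
by apply: ler_wpM2l => //; rewrite leNgt; apply: contra nA => /ltW; exact: fA.
Qed.

End FourCycles.

(** * The two models of random graphs *)

Section EdgeMoves.
Local Open Scope set_scope.
Variable n : nat.
Implicit Types (S : {set {set 'I_n}}) (e f : {set 'I_n}) (G : sgraph n).

Lemma graph_of_subproof S :
  S :&: [set e : {set 'I_n} | #|e| == 2%N] \subset [set e : {set 'I_n} | #|e| == 2%N].
Proof. exact: finset.subsetIr. Qed.

Definition graph_of S : sgraph n := SGraph (graph_of_subproof S).

Lemma in_graph_of S e : (e \in edges (graph_of S)) = (e \in S) && (#|e| == 2%N).
Proof. by rewrite !inE. Qed.

Lemma graph_ext G G' : edges G =i edges G' -> G = G'.
Proof. by move=> GG'; apply: val_inj; apply/finset.setP. Qed.

Definition toggle e G := graph_of [set f | (f \in edges G) (+) (f == e)].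

Lemma in_toggle e f G : #|e| == 2%N ->
  (f \in edges (toggle e G)) = (f \in edges G) (+) (f == e).
Proof.
move=> e2; rewrite in_graph_of inE; have [->|_] := eqVneq f e; first by rewrite e2 andbT.
by rewrite addbF; case fG: (f \in _); rewrite // (edge_card2 fG).
Qed.

Lemma toggleK e : #|e| == 2%N -> involutive (toggle e).
Proof. by move=> e2 G; apply: graph_ext => f; rewrite !in_toggle // -addbA addbb addbF. Qed.

Definition swap e f G := graph_of [set g | tperm e f g \in edges G].

Lemma in_swap e f g G : #|e| == 2%N -> #|f| == 2%N ->
  (g \in edges (swap e f G)) = (tperm e f g \in edges G).
Proof.
move=> e2 f2; rewrite in_graph_of inE; case gG: (_ \in edges G) => //=.
by have := edge_card2 gG; case: tpermP => [->|->|].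
Qed.

Lemma swapK e f : #|e| == 2%N -> #|f| == 2%N -> involutive (swap e f).
Proof. by move=> e2 f2 G; apply: graph_ext => g; rewrite !in_swap // tpermK. Qed.

Lemma nb_edges_swap e f G : #|e| == 2%N -> #|f| == 2%N ->
  nb_edges (swap e f G) = nb_edges G.
Proof.
move=> e2 f2; rewrite /nb_edges -[RHS](card_imset _ (@perm_inj _ (tperm e f))).
apply: eq_card => g; rewrite in_swap //; apply/idP/imsetP => [gG|[g' g'G ->]].
  by exists (tperm e f g); rewrite ?tpermK.
by rewrite tpermK.
Qed.

Lemma card_pairs : #|[set e : {set 'I_n} | #|e| == 2%N]| = 'C(n, 2).
Proof. by rewrite card_draws card_ord. Qed.

Lemma nb_edges_le G : (nb_edges G <= 'C(n, 2))%N.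
Proof. by rewrite -card_pairs subset_leq_card // edges_card2. Qed.

Lemma exists_nb_edges m : (m <= 'C(n, 2))%N -> exists G, nb_edges G = m.
Proof.
rewrite -card_pairs => mN; pose s := enum [set e : {set 'I_n} | #|e| == 2%N].
exists (graph_of [set e in take m s]); rewrite /nb_edges.
have -> : #|edges (graph_of [set e in take m s])| = size (take m s).
  rewrite -(card_uniqP (take_uniq _ (enum_uniq _))); apply: eq_card => e.
  rewrite in_graph_of inE; case es: (e \in take m s) => //=.
  by have := mem_take es; rewrite mem_enum inE.
by rewrite size_takel // -cardE.
Qed.

End EdgeMoves.

Section Gnp.
Variables (R : realType) (n : nat) (p : R).
Hypothesis p01 : 0 <= p <= 1.

Lemma gnp_pmf_ge0 (G : sgraph n) : 0 <= gnp_pmf p G.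
Proof.
have /andP[p0 p1] := p01; apply: prodr_ge0 => e _.
by case: ifP; rewrite ?subr_ge0.
Qed.

(** The product over all pairs of [p + (1 - p)], expanded. *)
Lemma gnp_total : \sum_(G : sgraph n) gnp_pmf p G = 1.
Proof.
pose F (e : {set 'I_n}) (b : bool) := if b then p else 1 - p.
transitivity (\prod_(e : {set 'I_n} | #|e| == 2%N) \sum_(b : bool) F e b); last first.
  by apply: big1 => e _; rewrite big_bool /F /=; ring.
rewrite (big_distr_big_dep false) /=.
pose ind (G : sgraph n) : {ffun {set 'I_n} -> bool} := [ffun e => e \in edges G].
rewrite (reindex_onto ind (fun f => graph_of [set e | f e]%SET)) /=; last first.
  move=> f /pfamilyP[supp _]; apply/ffunP => e; rewrite ffunE in_graph_of inE.
  case fe: (f e) => //=; have /(_ e) := fintype.subsetP supp.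
  by rewrite !inE fe; apply.
apply: eq_big => [G|G _]; last by apply: eq_bigr => e _; rewrite /F ffunE.
apply/esym/andP; split.
  apply/pfamilyP; split=> [|e _] //; apply/fintype.subsetP => e.
  by rewrite !inE ffunE; case eG: (e \in edges G) => // _; exact: edge_card2 eG.
apply/eqP/graph_ext => e; rewrite in_graph_of inE ffunE.
by case eG: (e \in edges G) => //=; exact: edge_card2 eG.
Qed.

(** Toggling [e] exchanges the two values of the indicator of [e] and negates
    its contribution to the mean, so the centered indicator of [e] has mean zero
    against anything that does not depend on [e]. *)
Lemma gnp_independent (e : {set 'I_n}) (h : sgraph n -> R) : #|e| == 2%N ->
  (forall G, h (toggle e G) = h G) ->
  \sum_G gnp_pmf p G * (((e \in edges G)%:R - p) * h G) = 0.
Proof.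
move=> e2 hT; set S := \sum_G _.
suff : S = - S by move=> ?; lra.
rewrite {1}/S (reindex_inj (inv_inj (toggleK e2))) -sumrN; apply: eq_bigr => G _.
rewrite hT !mulrA -mulNr; congr (_ * _).
rewrite /gnp_pmf !(bigD1 e e2) /= (in_toggle _ _ e2) eqxx.
rewrite (eq_bigr (fun f => if f \in edges G then p else 1 - p)); last first.
  by move=> f /andP[_ /negPf fe]; rewrite (in_toggle _ _ e2) fe addbF.
by case: (e \in edges G) => /=; ring.
Qed.

Lemma gnp_cycle (x x' y y' : 'I_n) :
  x != x' -> y != y' -> x != y -> x != y' -> x' != y -> x' != y' ->
  \sum_(G : sgraph n) gnp_pmf p G * (((adj G x y)%:R - p) * ((adj G x y')%:R - p) *
                   (((adj G x' y)%:R - p) * ((adj G x' y')%:R - p))) = 0.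
Proof.
move=> xx' yy' xy xy' x'y x'y'; under eq_bigr do rewrite -mulrA.
apply: gnp_independent => [|G]; first by rewrite cards2 xy.
have ne u v : (u != x) && (u != y) || (v != x) && (v != y) ->
    adj (toggle [set x; y]%SET G) u v = adj G u v.
  move=> uv; rewrite /adj in_toggle ?cards2 ?xy // [X in _ (+) X](_ : _ = false) ?addbF //.
  apply: contraTF uv => /eqP e; rewrite negb_or !negb_and !negbK.
  have := finset.set21 u v; have := finset.set22 u v; rewrite e !inE.
  by move=> -> ->.
have x'x : x' != x by rewrite eq_sym.
have y'y : y' != y by rewrite eq_sym.
have y'x : y' != x by rewrite eq_sym.
by rewrite (ne x y') ?(ne x' y) ?(ne x' y') // ?y'x ?y'y ?x'x ?x'y ?orbT.
Qed.

Lemma gnp_fourcycles : (0 < n)%N ->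
  \sum_(G : sgraph n) gnp_pmf p G * fourcycles p G <= 2 / n%:R.
Proof.
move=> n0; rewrite -[leRHS]addr0; apply: mean_fourcycles => //.
- exact: gnp_pmf_ge0.
- exact: gnp_total.
- by move=> *; rewrite gnp_cycle.
Qed.

End Gnp.

Section Gnm.
Variables (R : realType) (n m : nat).
Hypothesis mN : (m <= 'C(n, 2))%N.
Let N := 'C(n, 2).
Let p : R := m%:R / N%:R.

Definition gnm_pmf (G : sgraph n) : R :=
  (nb_edges G == m)%:R / #|[set G : sgraph n | nb_edges G == m]%SET|%:R.

Lemma gnm_count_gt0 : 0 < #|[set G : sgraph n | nb_edges G == m]%SET|%:R :> R.
Proof.
have [G /eqP Gm] := exists_nb_edges mN.
by rewrite ltr0n; apply/card_gt0P; exists G; rewrite inE.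
Qed.

Lemma gnm_pmf_ge0 G : 0 <= gnm_pmf G.
Proof. by rewrite divr_ge0. Qed.

Lemma gnm_total : \sum_(G : sgraph n) gnm_pmf G = 1.
Proof.
rewrite -mulr_suml -natr_sum -big_mkcond sum1_card -[X in X%:R / _]cardsE.
by rewrite divff // gt_eqF // gnm_count_gt0.
Qed.

Let X (e : {set 'I_n}) (G : sgraph n) : R := (e \in edges G)%:R - p.

(** The centered indicators of all pairs sum to zero on graphs with [m] edges,
    and the mean of a product of four of them does not depend on the last factor
    as long as the four pairs are distinct; hence that mean is at most the
    contribution of the three degenerate choices, divided by the number of the
    other choices. *)
Lemma gnm_product (e1 e2 e3 e4 : {set 'I_n}) : (3 < N)%N ->
  #|e4| == 2%N -> e4 \notin [:: e1; e2; e3] ->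
  \sum_G gnm_pmf G * (X e1 G * X e2 G * (X e3 G * X e4 G)) <= 3 / (N%:R - 3).
Proof.
move=> N3 e42 e4N.
have N0 : N%:R != 0 :> R by rewrite pnatr_eq0 -lt0n (leq_trans _ N3).
have p01 : 0 <= p <= 1.
  rewrite divr_ge0 //= ler_pdivrMr ?mul1r ?ler_nat //.
  by rewrite ltr0n (leq_trans _ N3).
have X1 e G : `|X e G| <= 1.
  have /andP[p0 p1] := p01; rewrite /X ler_norml.
  by case: (e \in _) => /=; lra.
pose M h := \sum_G gnm_pmf G * (X e1 G * X e2 G * (X e3 G * X h G)).
have M1 h : `|M h| <= 1.
  rewrite -gnm_total; apply: le_trans (ler_norm_sum _ _ _) _.
  apply: ler_sum => G _; rewrite normrM (ger0_norm (gnm_pmf_ge0 G)).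
  by rewrite ler_piMr ?gnm_pmf_ge0 // !normrM !mulr_ile1 ?mulr_ge0.
have Msum : \sum_(h : {set 'I_n} | #|h| == 2%N) M h = 0.
  rewrite exchange_big /=; apply: big1 => G _; rewrite -!mulr_sumr.
  have [Gm|Gm] := eqVneq (nb_edges G) m; last first.
    by rewrite /gnm_pmf (negPf Gm) !mul0r.
  rewrite (_ : \sum_(h : {set 'I_n} | #|h| == 2%N) X h G = 0) ?mulr0 //.
  have -> : \sum_(h : {set 'I_n} | #|h| == 2%N) X h G =
      \sum_(h : {set 'I_n} | #|h| == 2%N) (h \in edges G)%:R -
      \sum_(h in [set h : {set 'I_n} | #|h| == 2%N]%SET) p.
    by rewrite sumrB; congr (_ - _); apply: eq_bigl => h; rewrite inE.
  rewrite sumr_const card_pairs.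
  have -> : \sum_(h : {set 'I_n} | #|h| == 2%N) (h \in edges G)%:R = m%:R :> R.
    rewrite -Gm /nb_edges -sum1_card natr_sum big_mkcond [RHS]big_mkcond.
    apply: eq_bigr => h _; case hG: (h \in edges G); last by case: ifP.
    by rewrite (edge_card2 hG).
  by rewrite -[p *+ _]mulr_natr /p divfK // subrr.
have Mconst (h : {set 'I_n}) : #|h| == 2%N -> h \notin [:: e1; e2; e3] -> M h = M e4.
  move=> h2 hN; rewrite /M (reindex_inj (inv_inj (swapK h2 e42))).
  apply: eq_bigr => G _; rewrite /gnm_pmf nb_edges_swap //; congr (_ * _).
  have Xs g : g != h -> g != e4 -> X g (swap h e4 G) = X g G.
    by move=> gh g4; rewrite /X in_swap // tpermD // eq_sym.
  move: hN e4N; rewrite !inE !negb_or => /and3P[h1 h2' h3] /and3P[f1 f2 f3].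
  rewrite (Xs e1) 1?eq_sym // (Xs e2) 1?eq_sym // (Xs e3) 1?eq_sym //.
  by rewrite /X in_swap // tpermL.
rewrite -/(M e4).
pose E := [set h : {set 'I_n} | #|h| == 2%N]%SET.
pose D := [set h in E | h \in [:: e1; e2; e3]]%SET.
have D3 : (#|D| <= 3)%N.
  apply: leq_trans (card_size [:: e1; e2; e3]); apply: subset_leq_card.
  by apply/fintype.subsetP => h; rewrite inE => /andP[].
have cE : (#|D| + #|E :\: D|%SET)%N = N.
  rewrite /N -card_pairs -/E -(cardsID D E); congr (_ + _)%N; apply: eq_card => h.
  by rewrite !inE andbA andbb.
have : \sum_(h in D) M h + #|E :\: D|%SET%:R * M e4 = 0.
  rewrite -[RHS]Msum [RHS](bigID (fun h => h \in D)) /=; congr (_ + _).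
    by apply: eq_bigl => h; rewrite !inE andbA andbb.
  rewrite mulr_natl -sumr_const; apply: eq_big => h; rewrite !inE.
    by rewrite andbC; case: (#|h| == 2%N).
  by move=> /andP[hN h2]; rewrite [RHS]Mconst // !inE; move: hN; rewrite h2.
have Dle : - \sum_(h in D) M h <= 3.
  apply: le_trans (ler_norm _) _; rewrite normrN.
  apply: le_trans (ler_norm_sum _ _ _) _; apply: (@le_trans _ _ (\sum_(h in D) 1)).
    by apply: ler_sum.
  by rewrite sumr_const ler_nat.
have EDge : N%:R - 3 <= #|E :\: D|%SET%:R :> R.
  by rewrite lerBlDl -natrD ler_nat -cE leq_add2r.
have N3' : 0 < N%:R - 3 :> R by rewrite subr_gt0 ltr_nat.
move=> MD; have [M0|M0] := leP (M e4) 0.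
  by apply: le_trans M0 _; rewrite divr_ge0 // ltW.
rewrite ler_pdivlMr //; apply: le_trans Dle.
have -> : - \sum_(h in D) M h = #|E :\: D|%SET%:R * M e4 by lra.
by rewrite mulrC ler_pM2r.
Qed.

Lemma gnm_fourcycles : (0 < n)%N -> (3 < N)%N ->
  \sum_(G : sgraph n) gnm_pmf G * fourcycles p G <= 2 / n%:R + 3 / (N%:R - 3).
Proof.
move=> n0 N3; apply: mean_fourcycles => //.
- rewrite divr_ge0 //= ler_pdivrMr ?mul1r ?ler_nat //.
  by rewrite ltr0n (leq_trans _ N3).
- exact: gnm_pmf_ge0.
- exact: gnm_total.
- by rewrite divr_ge0 // subr_ge0 ler_nat ltnW.
move=> x x' y y' xx' yy' xy xy' x'y x'y'; apply: gnm_product => //.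
  by rewrite cards2 x'y'.
have ne (u v : 'I_n) : (u != x') && (u != y') || (v != x') && (v != y') ->
    ([set x'; y']%SET == [set u; v]%SET) = false.
  apply: contraTF => /eqP e; rewrite negb_or !negb_and !negbK.
  have := finset.set21 u v; have := finset.set22 u v; rewrite -e !inE.
  by move=> -> ->.
have yx' : y != x' by rewrite eq_sym.
by rewrite !inE (ne x y) ?(ne x y') ?(ne x' y) // ?xx' ?xy' ?yx' ?yy' ?orbT.
Qed.

End Gnm.

(** * Asymptotics *)

Section Asymptotics.
Variables (R : realType) (H : graph_class).
Arguments H : clear implicits.
Hypothesis hH : hereditary H.
Implicit Types (p eps : R).

Lemma bin2_double n : 2 * 'C(n, 2)%:R = n%:R * (n%:R - 1) :> R.
Proof.
case: n => [|n]; first by rewrite mulr0 mul0r.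
by rewrite -natrM -(mul_bin_diag n.+1 1) bin1 natrM -[X in _ * (X - 1)]natr1 addrK.
Qed.

Lemma bin2_le n : 'C(n, 2)%:R <= n%:R ^+ 2 / 2 :> R.
Proof. by have := bin2_double n; have := ler0n R n; nra. Qed.

Lemma bin2_ge n : (1 < n)%N -> n%:R ^+ 2 / 4 <= 'C(n, 2)%:R :> R.
Proof.
move=> n1; have : 2 <= n%:R :> R by rewrite ler_nat.
by have := bin2_double n; nra.
Qed.

Lemma low_discrepancy_shift n (G : sgraph n) p p' (gamma : R) :
  `|p - p'| <= gamma / 2 -> low_discrepancy (adj G) p' (gamma / 2) ->
  low_discrepancy (adj G) p gamma.
Proof.
move=> pp' disc A B.
have -> : \sum_(x in A) \sum_(y in B) ((adj G x y)%:R - p) =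
    \sum_(x in A) \sum_(y in B) ((adj G x y)%:R - p') + #|A|%:R * #|B|%:R * (p' - p).
  rewrite -mulrA !mulr_natl -!sumr_const -big_split; apply: eq_bigr => x _ /=.
  by rewrite -big_split; apply: eq_bigr => y _ /=; ring.
apply: le_trans (ler_normD _ _) _.
have ABn : `|#|A|%:R * #|B|%:R * (p' - p)| <= n%:R ^+ 2 * (gamma / 2).
  rewrite normrM ger0_norm ?mulr_ge0 // distrC ler_pM ?mulr_ge0 // expr2.
  by rewrite ler_pM // ler_nat -[X in (_ <= X)%N]card_ord max_card.
by have := disc A B; rewrite card_ord; lra.
Qed.

(** The number of edges is half of the sum over all pairs of vertices, with an
    error [p * n] from the diagonal. *)
Lemma low_discrepancy_edges n (G : sgraph n) p (gamma : R) : 0 <= p <= 1 ->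
  low_discrepancy (adj G) p gamma ->
  `|(nb_edges G)%:R - p * 'C(n, 2)%:R| <= (gamma * n%:R ^+ 2 + n%:R) / 2.
Proof.
move=> /andP[p0 p1] /(_ finset.setT finset.setT); rewrite card_ord.
have -> : \sum_(x in finset.setT) \sum_(y in finset.setT) ((adj G x y)%:R - p) =
    2 * (nb_edges G)%:R - n%:R ^+ 2 * p.
  rewrite -nb_edges_adj.
  have -> : n%:R ^+ 2 * p = \sum_(x : 'I_n) \sum_(y : 'I_n) p.
    by rewrite !sumr_const card_ord -[RHS]mulr_natr -[X in _ = X * _]mulr_natr; ring.
  rewrite -sumrB; apply: eq_big => [x|x _]; rewrite ?inE //.
  by rewrite -sumrB; apply: eq_bigl => y; rewrite inE.
have := bin2_double n; have n0 := ler0n R n; rewrite !ler_norml.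
set N := 'C(n, 2)%:R; set e := (nb_edges G)%:R => dN /andP[h1 h2].
have : 0 <= p * n%:R <= n%:R by rewrite mulr_ge0 //= ler_piMl.
move=> /andP[h3 h4]; apply/andP; split; nra.
Qed.

(** Quasirandom graphs with edge density about [p] are at the distance from [H]
    predicted by [f]. *)
Lemma quasirandom_Dist p eps : 0 <= p <= 1 -> 0 < eps ->
  exists2 kappa : R, 0 < kappa & exists2 d : R, 0 < d & exists n0 : nat,
  forall n p' (G : sgraph n), (n0 <= n)%N -> 0 <= p' <= 1 -> `|p - p'| <= d ->
    fourcycles p' G <= kappa ->
    f_of H p * 'C(n, 2)%:R - eps * n%:R ^+ 2 <= (Dist H G)%:R <=
    f_of H p * 'C(n, 2)%:R + eps * n%:R ^+ 2.
Proof.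
move=> p01 eps0; have [gamma0 gamma00 [n0 low]] := edit_dist_lower hH p01 eps0.
pose gamma := Num.min gamma0 eps.
have g0 : 0 < gamma by rewrite lt_min gamma00.
have g2 : 0 < gamma / 2 by rewrite divr_gt0.
exists ((gamma / 2 / 2) ^+ 4); first by rewrite exprn_gt0 // divr_gt0.
exists (gamma / 2) => //.
pose n1 := (Num.bound (2 / (gamma / 2)) + Num.bound eps^-1 + 2)%N.
exists (n0 + n1)%N => n p' G nn p'01 pp' four.
have [nn0 n2 ngamma neps] : [/\ (n0 <= n)%N, (1 < n)%N, 2 / (gamma / 2) <= n%:R & eps^-1 <= n%:R].
  have bnd (x : R) : 0 <= x -> (Num.bound x <= n)%N -> x <= n%:R.
    by move=> x0 xn; apply: le_trans (ltW (archi_boundP x0)) _; rewrite ler_nat.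
  split; first by apply: leq_trans nn; rewrite leq_addr.
  - by move: nn; rewrite /n1; lia.
  - by apply: bnd; [rewrite divr_ge0 // ltW|move: nn; rewrite /n1; lia].
  - by apply: bnd; [rewrite invr_ge0 ltW|move: nn; rewrite /n1; lia].
have disc : low_discrepancy (adj G) p gamma.
  exact: low_discrepancy_shift pp' (low_discrepancy_fourcycles p'01 g2 ngamma four).
have N0 : 0 < 'C(n, 2)%:R :> R by rewrite ltr0n bin_gt0.
have n20 : 0 <= n%:R ^+ 2 :> R by rewrite exprn_ge0.
have f0 := f_of_ge0 hH p01; have f1 := f_of_le1 hH p01.
apply/andP; split.
  apply: Dist_ge => [|F HF].
    apply: (@le_trans _ _ (f_of H p * 'C(n, 2)%:R)); last by rewrite ler_piMl // ltW.
    by rewrite gerBl mulr_ge0 // ltW.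
  have disc0 : low_discrepancy (adj G) p gamma0.
    move=> A B; apply: le_trans (disc A B) _; rewrite ler_wpM2r ?exprn_ge0 //.
    by rewrite ge_min lexx.
  have [K HK Kle] := low n G F nn0 disc0 HF.
  have := ler_wpM2r n20 (f_of_le p HK).
  have := ler_wpM2l f0 (bin2_le n); have := mulr_ge0 (ltW eps0) n20; lra.
apply: le_trans (Dist_le_f R hH G n2) _.
have := ler_wpM2r (ltW N0) (f_of_lipschitz hH ((nb_edges G)%:R / 'C(n, 2)%:R) p).
rewrite mulrDl => /le_trans; apply; rewrite lerD2l.
rewrite -[X in _ * X](ger0_norm (ltW N0)) -normrM mulrBl divfK ?gt_eqF //.
apply: le_trans (low_discrepancy_edges p01 disc) _.
have g_eps : gamma <= eps by rewrite ge_min lexx orbT.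
have : n%:R <= eps * n%:R ^+ 2.
  have ngt0 : 0 < n%:R :> R by rewrite ltr0n ltnW.
  by rewrite expr2 mulrA ler_peMl ?(ltW ngt0) // mulrC -ler_pdivrMr // div1r.
have := ler_wpM2r n20 g_eps; lra.
Qed.

Lemma five_div_eventually_lt (c : R) : 0 < c -> exists n0 : nat, forall n, (n0 <= n)%N ->
  (4 < n)%N /\ 5 / n%:R < c.
Proof.
move=> c0; exists (Num.bound (5 / c) + 5)%N => n nn.
have n5 : (4 < n)%N by move: nn; lia.
split=> //; rewrite ltr_pdivrMr ?ltr0n ?(ltn_trans _ n5) // mulrC -ltr_pdivrMr //.
apply: lt_le_trans (archi_boundP _) _; first by rewrite divr_ge0 // ltW.
by rewrite ler_nat; apply: leq_trans nn; rewrite leq_addr.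
Qed.

Lemma gnp_quasirandom p (kappa delta : R) : 0 <= p <= 1 -> 0 < kappa -> 0 < delta ->
  exists n0 : nat, forall n, (n0 <= n)%N -> forall A : set (sgraph n),
    (forall G, fourcycles p G <= kappa -> A G) -> 1 - delta < Pr_gnp p A.
Proof.
move=> p01 k0 d0; have [n0 n0P] := five_div_eventually_lt (mulr_gt0 d0 k0).
exists n0 => n nn A AP; have [n5 small] := n0P n nn.
have n1 : (0 < n)%N by exact: ltn_trans n5.
have := markov_mass (gnp_pmf_ge0 p01) (gnp_total n p) (fourcycles_ge0 p) k0
  (A := fun G => G \in A) (fun G _ Gk => mem_set (AP G Gk)).
apply: lt_le_trans; rewrite ltrD2l ltrN2 ltr_pdivrMr //.
apply: le_lt_trans (gnp_fourcycles p01 n1) _; apply: le_lt_trans small.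
by rewrite ler_pM2r ?ler_nat // invr_gt0 ltr0n.
Qed.

Lemma Pr_gnp_le1 n p (A : set (sgraph n)) : 0 <= p <= 1 -> Pr_gnp p A <= 1.
Proof.
move=> p01; rewrite -(gnp_total n p) [leRHS](bigID (fun G => G \in A)) /= lerDl.
by apply: sumr_ge0 => G _; exact: gnp_pmf_ge0.
Qed.

Lemma gnm_quasirandom (kappa delta : R) : 0 < kappa -> 0 < delta ->
  exists n0 : nat, forall n m, (n0 <= n)%N -> (m <= 'C(n, 2))%N ->
  forall A : set (sgraph n),
    (forall G, nb_edges G = m -> fourcycles (m%:R / 'C(n, 2)%:R : R) G <= kappa -> A G) ->
    1 - delta < \sum_(G in A) gnm_pmf R m G.
Proof.
move=> k0 d0; have [n0 n0P] := five_div_eventually_lt (mulr_gt0 d0 k0).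
exists n0 => n m nn mN A AP; have [n5 small] := n0P n nn.
have n1 : (0 < n)%N by exact: ltn_trans n5.
have n5' : 5 <= n%:R :> R by rewrite ler_nat.
have Nn : n%:R <= 'C(n, 2)%:R - 3 :> R by have := bin2_double n; nra.
have N3 : (3 < 'C(n, 2))%N by rewrite -(ltr_nat R); lra.
have mass (G : sgraph n) : gnm_pmf R m G != 0 -> nb_edges G = m.
  by rewrite /gnm_pmf; have [|_] := eqVneq (nb_edges G) m; rewrite ?mul0r ?eqxx.
have := markov_mass (fun G => gnm_pmf_ge0 R m G) (gnm_total R mN)
  (fourcycles_ge0 (m%:R / 'C(n, 2)%:R)) k0
  (A := fun G => G \in A) (fun G G0 Gk => mem_set (AP G (mass G G0) Gk)).
apply: lt_le_trans; rewrite ltrD2l ltrN2 ltr_pdivrMr //.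
apply: le_lt_trans (gnm_fourcycles R mN n1 N3) _; apply: le_lt_trans small.
have -> : 5 / n%:R = 2 / n%:R + 3 / n%:R :> R by rewrite -mulrDl; congr (_ / _); lra.
by rewrite lerD2l ler_pM2l // lef_pV2 ?posrE //; lra.
Qed.

Lemma Pr_gnmE n (x : R) (m : nat) (A : set (sgraph n)) :
  Num.floor x = m%:Z -> Pr_gnm x A = \sum_(G in A) gnm_pmf R m G.
Proof.
move=> xm; rewrite /Pr_gnm xm /gnm_pmf -mulr_suml; congr (_ / _).
  rewrite -sum1_card natr_sum big_mkcond [RHS]big_mkcond; apply: eq_bigr => G _.
  by rewrite inE eqz_nat; case: (nb_edges G == m); case: (G \in A).
Qed.

Lemma cvg_to_1 (u : nat -> R) : (forall n, u n <= 1) ->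
  (forall delta, 0 < delta -> exists n0 : nat, forall n, (n0 <= n)%N -> 1 - delta < u n) ->
  u n @[n --> \oo] --> (1 : R).
Proof.
move=> u1 uP; apply/cvgrPdist_le => e e0; have [n0 n0P] := uP e e0.
near=> n; rewrite ler_norml; have := u1 n; have := n0P n.
have -> : (n0 <= n)%N by near: n; exact: nbhs_infty_ge.
by move=> /(_ isT); lra.
Unshelve. all: by end_near. Qed.

Lemma floor_density p n : 0 <= p <= 1 -> exists2 m : nat,
  Num.floor (p * 'C(n, 2)%:R) = m%:Z & (m <= 'C(n, 2))%N /\
  m%:R <= p * 'C(n, 2)%:R < m%:R + 1.
Proof.
move=> /andP[p0 p1]; set x := p * _.
have x0 : 0 <= x by rewrite mulr_ge0.
have : (0 <= Num.floor x)%R by rewrite floor_ge0.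
case E : (Num.floor x) => [m|//] _; exists m => //.
have /andP[mx xm] := floor_itv (x : R); rewrite E in mx xm.
have mx' : m%:R <= x by [].
have xm' : x < m%:R + 1 by rewrite intrD in xm.
split; last by rewrite mx'.
by rewrite -(ler_nat R); apply: le_trans mx' _; rewrite ler_piMl.
Qed.

End Asymptotics.

(** * The limits *)

Section Limits.
Variables (R : realType) (H : graph_class).
Arguments H : clear implicits.
Hypothesis hH : hereditary H.
Implicit Types (p eps : R).

Lemma Dist_le_maxDist n (G : sgraph n) : (Dist H G <= maxDist H n)%N.
Proof. exact: (leq_bigmax (F := fun G => Dist H G) G). Qed.

Lemma density01 n (G : sgraph n) : (1 < n)%N ->
  0 <= ((nb_edges G)%:R / 'C(n, 2)%:R : R) <= 1.
Proof.
move=> n1; rewrite divr_ge0 //= ler_pdivrMr ?ltr0n ?bin_gt0 //.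
by rewrite mul1r ler_nat nb_edges_le.
Qed.

Lemma maxDist_le p n : 0 <= p <= 1 ->
  (forall q : R, 0 <= q <= 1 -> f_of H q <= f_of H p) -> (1 < n)%N ->
  (maxDist H n)%:R <= f_of H p * 'C(n, 2)%:R.
Proof.
move=> p01 pmax n1; have fN0 : 0 <= f_of H p * 'C(n, 2)%:R.
  by rewrite mulr_ge0 // f_of_ge0.
rewrite /maxDist; apply: (big_ind (fun x : nat => x%:R <= f_of H p * 'C(n, 2)%:R)) => //.
  by move=> x y xf yf; rewrite /maxn; case: ifP.
move=> G _; apply: le_trans (Dist_le_f R hH G n1) _.
by rewrite ler_wpM2r // pmax // density01.
Qed.

(** A quasirandom graph of density [p] exists because a random one is so with
    positive probability. *)
Lemma maxDist_ge p eps : 0 <= p <= 1 -> 0 < eps ->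
  exists n0 : nat, forall n, (n0 <= n)%N ->
    f_of H p * 'C(n, 2)%:R - eps * n%:R ^+ 2 <= (maxDist H n)%:R.
Proof.
move=> p01 eps0; have [kappa k0 [d d0 [n0 qr]]] := quasirandom_Dist hH p01 eps0.
have [n1 typ] := gnp_quasirandom p01 k0 ltr01.
exists (n0 + n1)%N => n nn.
have nn0 : (n0 <= n)%N by apply: leq_trans nn; rewrite leq_addr.
have nn1 : (n1 <= n)%N by apply: leq_trans nn; rewrite leq_addl.
have := typ n nn1 [set G | fourcycles p G <= kappa]%classic (fun G Gk => Gk).
rewrite subrr => Pr0; apply: contrapT => /negP; rewrite -ltNge => small.
move: Pr0; rewrite /Pr_gnp big_pred0 ?ltxx // => G; apply/negP; rewrite inE /= => Gk.
have dpp : `|p - p| <= d by rewrite subrr normr0 ltW.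
have /andP[low _] := qr n p G nn0 p01 dpp Gk.
by have := lt_le_trans small low; rewrite ltr_nat ltnNge Dist_le_maxDist.
Qed.

Lemma edit_ratio_cvg p : 0 <= p <= 1 ->
  (forall q : R, 0 <= q <= 1 -> f_of H q <= f_of H p) ->
  edit_ratio R H n @[n --> \oo] --> f_of H p.
Proof.
move=> p01 pmax; apply/cvgrPdist_le => e e0.
have [n0 n0P] := maxDist_ge p01 (divr_gt0 e0 (ltr0Sn _ 3)).
near=> n.
have n1 : (1 < n)%N by near: n; exact: nbhs_infty_ge.
have nn0 : (n0 <= n)%N by near: n; exact: nbhs_infty_ge.
have N0 : 0 < 'C(n, 2)%:R :> R by rewrite ltr0n bin_gt0.
have up := maxDist_le p01 pmax n1; have low := n0P n nn0; have N4 := bin2_ge R n1.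
rewrite /edit_ratio ler_distlC; apply/andP; split.
  by rewrite ler_pdivlMr //; nra.
by rewrite ler_pdivrMr //; nra.
Unshelve. all: by end_near. Qed.

Lemma pstar_of_max p : 0 <= p <= 1 ->
  (forall q : R, 0 <= q <= 1 -> f_of H q <= f_of H p) -> is_pstar H p.
Proof.
move=> p01 pmax eps eps0; apply: cvg_to_1 => [n|delta delta0].
  exact: Pr_gnp_le1.
have [kappa k0 [d d0 [n0 qr]]] := quasirandom_Dist hH p01 eps0.
have [n1 typ] := gnp_quasirandom p01 k0 delta0.
exists (n0 + n1 + 2)%N => n nn.
have [nn0 nn1 n2] : [/\ (n0 <= n)%N, (n1 <= n)%N & (1 < n)%N].
  by clear -nn; split; lia.
apply: typ => // G Gk /=.
have dpp : `|p - p| <= d by rewrite subrr normr0 ltW.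
have /andP[low _] := qr n p G nn0 p01 dpp Gk.
have up := maxDist_le p01 pmax n2; have mono : (Dist H G)%:R <= (maxDist H n)%:R :> R.
  by rewrite ler_nat Dist_le_maxDist.
by rewrite ger0_norm; lra.
Qed.

(** With probability close to one [Dist H G] is both close to [maxDist H n] and
    close to [f p * N]; as [maxDist H n] is at least about [f q * N], a single
    graph with both properties gives [f q <= f p]. *)
Lemma max_of_pstar p : 0 <= p <= 1 -> is_pstar H p ->
  forall q : R, 0 <= q <= 1 -> f_of H q <= f_of H p.
Proof.
move=> p01 pst q q01; rewrite leNgt; apply/negP => fpq.
pose eps := (f_of H q - f_of H p) / 16.
have eps0 : 0 < eps by rewrite divr_gt0 // subr_gt0.
have [kappa k0 [d d0 [n0 qr]]] := quasirandom_Dist hH p01 eps0.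
have half : (0 : R) < 2^-1 by lra.
have [n1 typ] := gnp_quasirandom p01 k0 half.
have [n2 big] := maxDist_ge q01 eps0.
have /cvgrPdist_lt/(_ _ half)[n3 _ n3P] := pst eps eps0.
pose n := (n0 + n1 + n2 + n3 + 2)%N.
have [nn0 nn1 nn2 nn3 n1n] :
    [/\ (n0 <= n)%N, (n1 <= n)%N, (n2 <= n)%N, (n3 <= n)%N & (1 < n)%N].
  by rewrite /n; clear; split; lia.
have := n3P n nn3; set A := (X in Pr_gnp p X) => /=.
rewrite ger0_norm ?subr_ge0 ?Pr_gnp_le1 // => PA.
have PB := typ n nn1 (~` A)%classic _.
have [G GA Gk] : exists2 G, A G & fourcycles p G <= kappa.
  apply: contrapT => nG; have {}PB : 1 - 2^-1 < Pr_gnp p (~` A)%classic.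
    by apply: PB => G Gk GA; apply: nG; exists G.
  suff : Pr_gnp p A + Pr_gnp p (~` A)%classic = 1 by lra.
  rewrite -(gnp_total n p) [RHS](bigID (fun G => G \in A)) /=; congr (_ + _).
  by apply: eq_bigl => G; rewrite in_setC.
have dpp : `|p - p| <= d by rewrite subrr normr0 ltW.
have /andP[_ up] := qr n p G nn0 p01 dpp Gk.
have low := big n nn2; have N4 := bin2_ge R n1n.
have GA' : `|(maxDist H n)%:R - (Dist H G)%:R| <= eps * n%:R ^+ 2 := GA.
have := le_trans (ler_norm _) GA' => close.
have feps : f_of H q = f_of H p + 16 * eps by rewrite /eps; lra.
have n20 : 0 < n%:R ^+ 2 :> R by rewrite exprn_gt0 // ltr0n ltnW.
have en0 := mulr_gt0 eps0 n20.
have eN := ler_wpM2l (ltW eps0) N4.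
rewrite feps mulrDl in low; lra.
Qed.

Lemma Pr_gnm_le1 n (x : R) (A : set (sgraph n)) : Pr_gnm x A <= 1.
Proof.
rewrite /Pr_gnm; set D := (X in _ / #|X|%:R); have [D0|D0] := posnP #|D|.
  by rewrite D0 invr0 mulr0.
rewrite ler_pdivrMr ?ltr0n // mul1r ler_nat; apply: subset_leq_card.
by apply/fintype.subsetP => G; rewrite !inE => /andP[].
Qed.

Lemma Pr_gnm_quasirandom p eps delta : 0 < p < 1 -> 0 < eps -> 0 < delta ->
  exists n0 : nat, forall n, (n0 <= n)%N ->
    1 - delta < Pr_gnm (p * 'C(n, 2)%:R) [set G : sgraph n |
       f_of H p * 'C(n, 2)%:R - eps * n%:R ^+ 2 <= (Dist H G)%:R :> R]%classic.
Proof.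
move=> /andP[p0 p1] eps0 delta0; have p01 : 0 <= p <= 1 by rewrite !ltW.
have [kappa k0 [d d0 [n0 qr]]] := quasirandom_Dist hH p01 eps0.
have [n1 typ] := gnm_quasirandom k0 delta0.
have [n2 small] := five_div_eventually_lt d0.
exists (n0 + n1 + n2)%N => n nn.
have [nn0 nn1 nn2] : [/\ (n0 <= n)%N, (n1 <= n)%N & (n2 <= n)%N].
  by clear -nn; split; lia.
have [m mE [mN /andP[mx xm]]] := floor_density n p01.
rewrite (Pr_gnmE _ mE); apply: typ => // G Gm Gk /=.
have [n5 dn] := small n nn2.
have n5' : 5 <= n%:R :> R by rewrite ler_nat.
have Nn : n%:R <= 'C(n, 2)%:R :> R by have := bin2_double R n; nra.
have N0 : 0 < 'C(n, 2)%:R :> R by lra.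
have mp01 : 0 <= (m%:R / 'C(n, 2)%:R : R) <= 1.
  by rewrite divr_ge0 //= ler_pdivrMr // mul1r ler_nat.
have dpm : `|p - m%:R / 'C(n, 2)%:R| <= d.
  have mp : m%:R / 'C(n, 2)%:R <= p by rewrite ler_pdivrMr.
  rewrite ger0_norm ?subr_ge0 //; apply: le_trans (ltW dn).
  have pm : p <= (m%:R + 1) / 'C(n, 2)%:R by rewrite ler_pdivlMr // ltW.
  have Vn : 'C(n, 2)%:R^-1 <= n%:R^-1 :> R by rewrite lef_pV2 ?posrE //; lra.
  have Vn0 : 0 <= n%:R^-1 :> R by rewrite invr_ge0.
  by rewrite mulrDl div1r in pm; lra.
by have /andP[] := qr n _ G nn0 mp01 dpm Gk.
Qed.

(** The upper bound holds for every graph with that number of edges, the rounding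
    costing at most [1] because [f] is Lipschitz; a random one attains the lower
    bound. *)
Lemma maxDist_size_littleo p : 0 < p < 1 ->
  (fun n : nat => (maxDist_size H n (Num.floor (p * 'C(n, 2)%:R)))%:R) =
  (fun n : nat => f_of H p * 'C(n, 2)%:R) +o_\oo (fun n : nat => n%:R ^+ 2 : R).
Proof.
move=> p01; have /andP[p0 p1] := p01; have p01' : 0 <= p <= 1 by rewrite !ltW.
apply/eqaddoP => eps eps0; have [n0 low] := Pr_gnm_quasirandom p01 eps0 (@ltr01 R).
near=> n.
have nn0 : (n0 <= n)%N by near: n; exact: nbhs_infty_ge.
have n1 : (1 < n)%N by near: n; exact: nbhs_infty_ge.
have epsn : 1 <= eps * n%:R.
  have : eps^-1 <= n%:R by near: n; exact: nbhs_infty_ger.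
  by rewrite -ler_pdivrMl // mulr1.
have n1R : 1 <= n%:R :> R by rewrite ler1n ltnW.
have epsn2 : 1 <= eps * n%:R ^+ 2.
  rewrite expr2 mulrA; apply: le_trans epsn _; rewrite ler_peMr //.
  by rewrite mulr_ge0 // ltW.
have [m mE [mN /andP[mx xm]]] := floor_density n p01'.
have N0 : 0 < 'C(n, 2)%:R :> R by rewrite ltr0n bin_gt0.
have goal : `|(maxDist_size H n m%:Z)%:R - f_of H p * 'C(n, 2)%:R| <= eps * n%:R ^+ 2.
  rewrite ler_distl; apply/andP; split.
    have := low n nn0; rewrite subrr (Pr_gnmE _ mE) => Pr0.
    apply: contrapT => /negP; rewrite -ltNge => small; move: Pr0.
    rewrite big1 ?ltxx // => G; rewrite inE /= => Glow.
    rewrite /gnm_pmf; have [Gm|_] := eqVneq (nb_edges G) m; last by rewrite mul0r.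
    have := lt_le_trans small Glow; rewrite ltr_nat ltnNge => /negP[].
    by apply: (leq_bigmax_cond (F := fun G => Dist H G)); rewrite Gm.
  apply: (big_ind (fun x : nat => x%:R <= f_of H p * 'C(n, 2)%:R + eps * n%:R ^+ 2)).
  - by rewrite addr_ge0 ?mulr_ge0 ?f_of_ge0 // ltW.
  - by move=> x y xf yf; rewrite /maxn; case: ifP.
  move=> G; rewrite eqz_nat => /eqP Gm; apply: le_trans (Dist_le_f R hH G n1) _.
  rewrite Gm; have := ler_wpM2r (ltW N0) (f_of_lipschitz hH (m%:R / 'C(n, 2)%:R) p).
  rewrite mulrDl => /le_trans; apply; rewrite lerD2l; apply: le_trans epsn2.
  rewrite -[X in _ * X](ger0_norm (ltW N0)) -normrM mulrBl divfK ?gt_eqF //.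
  by rewrite ler_norml; lra.
move: goal; rewrite -mE => /le_trans; apply.
by rewrite ler_wpM2l ?(ltW eps0) // ler_norm.
Unshelve. all: by end_near. Qed.

End Limits.

Theorem theorem11 (R : realType) (H : graph_class) (hH : hereditary H) :
  cvgn (edit_ratio R H) /\
  (forall p : R, 0 <= p <= 1 -> f_of H p = g_of H p) /\
  is_max_on `[0, 1] (@f_of R H) (dstar R H) /\
  is_max_on `[0, 1] (@g_of R H) (dstar R H) /\
  (forall p : R, 0 <= p <= 1 ->
     (is_pstar H p <-> forall q : R, 0 <= q <= 1 -> f_of H q <= f_of H p)) /\
  convex_function (`[0, 1] : set R^o) (fun p : R^o => - f_of H p) /\
  (forall p : R, 0 < p < 1 ->
     (fun n : nat => (maxDist_size H n (Num.floor (p * 'C(n, 2)%:R)))%:R) =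
     (fun n : nat => f_of H p * 'C(n, 2)%:R) +o_\oo
       (fun n : nat => n%:R ^+ 2 : R)) /\
  (forall p eps : R, 0 < p < 1 -> 0 < eps ->
     Pr_gnm (p * 'C(n, 2)%:R) [set G : sgraph n |
       (f_of H p * 'C(n, 2)%:R - eps * n%:R ^+ 2 <= (Dist H G)%:R :> R)]
     @[n --> \oo] --> (1 : R)).
Proof.
have [pm pm01 pmax] := f_of_max R hH.
have ratio := edit_ratio_cvg hH pm01 pmax.
have dstarE : dstar R H = f_of H pm by exact: cvg_lim ratio.
have unit p : `[0, 1]%classic p = (0 <= p <= 1) :> Prop by rewrite /= in_itv.
have fg := f_of_eq_g_of hH.
split; first by apply/cvg_ex; exists (f_of H pm).
split; first exact: fg.
split.
  by split; [exists pm; rewrite ?unit|move=> q; rewrite unit dstarE; exact: pmax].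
split.
  split; first by exists pm; rewrite ?unit // -fg.
  by move=> q; rewrite unit dstarE => q01; rewrite -fg //; exact: pmax.
split.
  move=> p p01; split; [exact: max_of_pstar|exact: pstar_of_max].
split.
  move=> t p q; rewrite !inE !unit => p01 q01.
  have t01 : 0 <= (t%:num : R) <= 1 by rewrite ge0 le1.
  have concave := f_of_concave hH p q t01.
  rewrite convRE; have neg : - f_of H (t%:num * p + (1 - t%:num) * q : R) <=
      t%:num * - f_of H p + (1 - t%:num) * - f_of H q by lra.
  exact: neg.
split; first exact: maxDist_size_littleo.
move=> p eps p01 eps0; apply: cvg_to_1 => [n|delta delta0]; first exact: Pr_gnm_le1.
exact: Pr_gnm_quasirandom.
Qed.
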